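(* Let $l$ be a fixed positive integer and let $\widetilde O_{k+1}=J(2k+1;k,k+1)$. Then, as $k\to\infty$ (with implied constants depending only on $l$): (i) For $l\ge 3$: $\mathrm{ex}(\widetilde O_{k+1},C_{4l})=O(k^{-\frac12+\frac1l})\,e(\widetilde O_{k+1})$. (ii) For $l\ge 3$: $\mathrm{ex}(\widetilde O_{k+1},C_{4l+2})=O(k^{-\frac{1}{2l+1}})\,e(\widetilde O_{k+1})$ if $l\in\{3,5,7,9\}$, and $\mathrm{ex}(\widetilde O_{k+1},C_{4l+2})=O(k^{-\frac1{16}+\frac{1}{8(l-1)}})\,e(\widetilde O_{k+1})$ otherwise. (iii) For every $k\ge1$, $\mathrm{ex}(\widetilde O_{k+1},C_6)\le \frac56 e(\widetilde O_{k+1})$; moreover $\mathrm{ex}(\widetilde O_{k+1},C_8)\le (\frac23+o(1))e(\widetilde O_{k+1})$ and $\mathrm{ex}(\widetilde O_{k+1},C_{10})\le(\frac23+o(1))e(\widetilde O_{k+1})$, where $o(1)\to0$ as $k\to\infty$.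
   Context: For positive integers $n\ge k+1$, the doubled Johnson graph $J(n;k,k+1)$ is the bipartite graph with vertex set $\binom{[n]}{k}\cup\binom{[n]}{k+1}$, where two vertices $u,v$ are adjacent iff $u\subset v$ or $v\subset u$. The doubled Odd graph is $\widetilde O_{k+1}=J(2k+1;k,k+1)$; it has $(k+1)\binom{2k+1}{k}$ edges. $C_m$ denotes the cycle of length $m$. $\mathrm{ex}(G,H)$ is the maximum number of edges of a subgraph of $G$ containing no subgraph isomorphic to $H$. *)

(* Defs.v *)
From mathcomp Require Import all_boot.
Set Implicit Arguments. Unset Strict Implicit. Unset Printing Implicit Defensive.

Definition vtx (k : nat) := {set 'I_(2 * k + 1)}.

(* An edge {A, B} of the doubled Odd graph, A a k-set, B a (k+1)-set, A \subset B,
   is recorded as the ordered pair (A, B) (the graph is bipartite, so this is a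
   bijection with unordered edges). *)
Definition dO_edges (k : nat) : {set (vtx k * vtx k)} :=
  [set p : vtx k * vtx k | [&& #|p.1| == k, #|p.2| == k.+1 & p.1 \subset p.2]].

Definition e_dO (k : nat) : nat := #|dO_edges k|.

Definition adjF k (F : {set (vtx k * vtx k)}) : rel (vtx k) :=
  fun x y => ((x, y) \in F) || ((y, x) \in F).

Definition hasCycle k (m : nat) (F : {set (vtx k * vtx k)}) : bool :=
  [exists s : m.-tuple (vtx k), uniq s && cycle (adjF F) s].

Definition ex_dO (k m : nat) : nat :=
  \max_(F : {set (vtx k * vtx k)} | (F \subset dO_edges k) && ~~ hasCycle m F) #|F|.

(* Main.v *)
Require Import Defs.
From Stdlib Require Import Reals Lra.
From mathcomp Require Import all_boot zify.
Set Implicit Arguments. Unset Strict Implicit. Unset Printing Implicit Defensive.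

(** Regard F as a set of edges of the cube, and write x^i for x with the element
    i toggled.  For every x let G_x be the graph on the ground set in which i and
    j are joined when x^i, x^ij, x^j is a path of F; an m-cycle of G_x lifts to a
    2m-cycle of F, and a double count gives
      sum_x 2 e(G_x) = sum_v deg v (deg v - 1).

    - Cycles of length 4l: G_x has no 2l-cycle, hence O(n^(1+1/l)) edges
      (Bondy-Simonovits), so F has density O(k^(-1/2+1/(2l))).
    - Cycles of length 4l+2, l >= 3: counting 4-cycles in the graphs G_x shows
      that the edges of F lying on only O(n^2) octagons have density O(k^(-1/7)).
      The other edges of F contain no cycle of length 4(l-1): one of its edges
      could be replaced by the rest of an octagon disjoint from the cycle, which
      gives a cycle of length 4(l-1)+6 = 4l+2.
    - Hexagons: every edge lies on equally many of them, and each one misses F.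
    - Decagons: G_x has no 5-cycle, hence O(n^2) triangles, so F has a negligible
      proportion of hexagons.  For the normalised adjacency operator M
      of F this yields 3 <1, M^4 1> <= 2 <1, M^3 1> + o(1), and
      3 t^4 - 2 t^3 - (8/9)(t - 2/3) = 3 (t^2 - t/3 - 2/9)^2 + (t - 2/3)^2
      bounds the density <1, M 1> / <1, 1> by 2/3 + o(1). *)

(** * Even cycles, triangles and 4-cycles in graphs *)

(** Cauchy-Schwarz against the constant 1: sum [2 * (a i * a j) <= a i ^ 2 + a j ^ 2] over ordered
    pairs. *)
Lemma sum_nat_sqr_le (I : finType) (P : pred I) (a : I -> nat) :
  (\sum_(i | P i) a i) ^ 2 <= #|P| * \sum_(i | P i) a i ^ 2.
Proof.
rewrite -(leq_pmul2l (isT : 0 < 2)).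
have -> : (\sum_(i | P i) a i) ^ 2 = \sum_(i | P i) \sum_(j | P j) a i * a j.
  by rewrite -mulnn big_distrl; apply: eq_bigr => i _; rewrite big_distrr.
have -> : 2 * (#|P| * \sum_(i | P i) a i ^ 2) =
    \sum_(i | P i) \sum_(j | P j) (a i ^ 2 + a j ^ 2).
  transitivity (\sum_(i | P i) (#|P| * a i ^ 2 + \sum_(j | P j) a j ^ 2)).
    by rewrite big_split /= -big_distrr /= sum_nat_const mul2n -addnn.
  by apply: eq_bigr => i _; rewrite big_split /= sum_nat_const.
rewrite big_distrr /=; apply: leq_sum => i _.
by rewrite big_distrr /=; apply: leq_sum => j _; apply: nat_Cauchy.
Qed.

Section Graph.
Variables (T : finType).
Implicit Types (e : rel T) (U W S : {set T}).

(** Ordered pairs are counted, so for symmetric [e] an edge between distinct vertices of [U] counts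
    twice. *)
Definition edges_in e U := \sum_(x in U) #|[set y in U | e x y]|.

(** Deleting a vertex of degree at most [D] loses at most [2 * D] ordered pairs, so the hypothesis
    survives; it fails for the empty set, hence the deletion stops earlier. *)
Lemma min_degree_subset e U (D : nat) : symmetric e ->
  2 * D * #|U| < edges_in e U ->
  exists2 W : {set T}, W \subset U & W != set0 /\
    {in W, forall x, D < #|[set y in W | e x y]|}.
Proof.
move=> esym; have [n] := ubnP #|U|; elim: n U => // n IHn U ltUn ltU.
have [/forall_inP allU | ] := boolP [forall x in U, D < #|[set y in U | e x y]|].
  exists U => //; split => //; apply: contraTneq ltU => ->.
  by rewrite /edges_in big_set0.
rewrite negb_forall_in => /exists_inP [x Ux]; rewrite -leqNgt => lex.
have cU : #|U| = #|U :\ x|.+1 by rewrite (cardsD1 x U) Ux.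
have [||W sW HW] := IHn (U :\ x); first lia.
  have deg1 y : #|[set z in U | e y z]| = e y x + #|[set z in U :\ x | e y z]|.
    rewrite (cardsD1 x) !inE Ux /=; congr (_ + #|pred_of_set _|).
    by apply/setP => z; rewrite !inE andbA.
  have split_x : edges_in e U =
      #|[set y in U | e x y]| + (\sum_(y in U :\ x) e y x + edges_in e (U :\ x)).
    rewrite /edges_in (big_setD1 x Ux) /= -big_split; congr (_ + _).
    by apply: eq_bigr => y _; rewrite deg1.
  have : \sum_(y in U :\ x) e y x <= #|[set y in U | e x y]|.
    rewrite -sum1_card big_mkcond [leqRHS]big_mkcond /=.
    apply: leq_sum => y _; rewrite !inE esym.
    by case: (y == x); case: (y \in U); case: (e x y).
  rewrite cU split_x in ltU; nia.
exists W => //; exact: subset_trans sW (subD1set _ _).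
Qed.

(** Averaging over all 2-colourings: recolouring one end of an edge exchanges the colourings that
    cut it with those that do not, so exactly half cut it. *)
Lemma half_edges_cross e : symmetric e -> irreflexive e ->
  exists f : T -> bool, \sum_x \sum_y e x y <=
    2 * \sum_x \sum_y (e x y && (f x != f y)).
Proof.
move=> esym eirr.
pose flip (x : T) (f : {ffun T -> bool}) := [ffun z => (z == x) (+) f z].
have flipK x : involutive (flip x).
  by move=> f; apply/ffunP => z; rewrite !ffunE addbA addbb.
have half x y : x != y ->
    2 * #|[set f : {ffun T -> bool} | f x != f y]| = #|{ffun T -> bool}|.
  move=> nxy; rewrite mul2n -addnn.
  have {2}-> : #|[set f : {ffun T -> bool} | f x != f y]| =
      #|[set f : {ffun T -> bool} | f x == f y]|.
    rewrite -(card_imset _ (inv_inj (flipK x))); apply: eq_card => f.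
    apply/imsetP/idP => [[g + ->]|]; rewrite !inE ?ffunE ?eqxx ?(eq_sym y) ?(negPf nxy).
      by case: (g x); case: (g y).
    move=> fxy; exists (flip x f); rewrite ?flipK // !inE !ffunE eqxx.
    by rewrite (eq_sym y) (negPf nxy) (eqP fxy); case: (f y).
  rewrite -[RHS]cardsT -[RHS](cardsID [set f : {ffun T -> bool} | f x == f y]) addnC; congr (_ + _); apply: eq_card => f.
    by rewrite !inE.
  by rewrite !inE andbT.
pose cut (f : {ffun T -> bool}) := \sum_x \sum_y (e x y && (f x != f y)).
have [/existsP[f le_f]|] := boolP [exists f, \sum_x \sum_y e x y <= 2 * cut f].
  by exists f.
rewrite negb_exists => /forallP lt_cut; exfalso.
have: \sum_f 2 * cut f < \sum_(f : {ffun T -> bool}) \sum_x \sum_y e x y.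
  (* One term is split off because a sum of strict inequalities is strict only over a nonempty
     range. *)
  pose f0 := [ffun _ : T => true].
  rewrite (bigD1 f0) //= [ltnRHS](bigD1 f0) //= -addSn; apply: leq_add.
    by rewrite ltnNge lt_cut.
  by apply: leq_sum => f _; apply: ltnW; rewrite ltnNge lt_cut.
rewrite ltnNge => /negP; apply.
have -> : \sum_f 2 * cut f = \sum_x \sum_y
    2 * \sum_(f : {ffun T -> bool}) (e x y && (f x != f y)).
  rewrite -big_distrr /= /cut exchange_big /= big_distrr; apply: eq_bigr => x _ /=.
  by rewrite exchange_big /= big_distrr.
rewrite exchange_big; apply: leq_sum => x _; rewrite exchange_big.
apply: leq_sum => y _ /=; rewrite sum_nat_const.
case exy: (e x y) => //=; last by rewrite muln0.
rewrite -(half x y) ?muln1; last by apply: contraTneq exy => ->; rewrite eirr.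
by rewrite leq_mul2l /= -sum1_card big_mkcond leq_sum // => f _; rewrite !inE; case: ifP.
Qed.

(** Every vertex of [S] has more than [D] neighbours in [S], while the list [Z] together with the
    vertices already passed never exceeds [D] at a choice. *)
Lemma greedy_path e S (D q : nat) (Z : seq T) (x : T) :
  {in S, forall y, D < #|[set z in S | e y z]|} -> x \in S ->
  size Z + q <= D ->
  exists p, [/\ path e x p, size p = q, uniq p, {subset p <= S}
              & {in p, forall y, y \notin x :: Z}].
Proof.
move=> minS; elim: q Z x => [|q IHq] Z x Sx leD; first by exists [::].
have /subsetPn[y] : ~~ ([set z in S | e x z] \subset [set z in x :: Z]).
  apply: contraL (minS x Sx) => /subset_leq_card le1; rewrite -leqNgt.
  apply: leq_trans le1 _; rewrite cardsE; apply: leq_trans (card_size _) _ => /=; lia.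
rewrite !inE => /andP[Sy exy] nyZ.
have [|p [pp sp up Sp np]] := IHq (x :: Z) y Sy; first by rewrite /=; lia.
exists (y :: p); split => //=.
- by rewrite exy.
- by rewrite sp.
- rewrite up andbT; apply/negP => /np; by rewrite inE eqxx.
- by move=> z /[1!inE] /predU1P[->//|/Sp].
- by move=> z /[1!inE] /predU1P[->//|/np]; rewrite !inE !negb_or => /and3P[_ -> ->].
Qed.


(** * Even cycles through two consecutive layers of a rooted tree *)

Section LayerCycle.
Variables (e : rel T) (lev : T -> nat) (p : T -> T) (r : T) (i l D : nat) (S : {set T}).
Hypothesis esym : symmetric e.
Hypothesis parP : forall x, 0 < lev x <= i -> e (p x) x /\ lev (p x) = (lev x).-1.
Hypothesis lev0 : forall x, lev x = 0 -> x = r.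
Hypothesis levS : {in S, forall x, lev x = i \/ lev x = i.+1}.
Hypothesis bipS : {in S &, forall x y, e x y -> lev x != lev y}.
Hypothesis minS : {in S, forall y, D < #|[set z in S | e y z]|}.

Lemma lev_iter_parent x a : lev x = i -> a <= i -> lev (iter a p x) = i - a.
Proof.
move=> lx; elim: a => [|a IHa] lea /=; first lia.
have la := IHa (ltnW lea).
by have [|_ ->] := parP (x := iter a p x); rewrite la; lia.
Qed.

Lemma ancestor_edge x a : lev x = i -> a < i ->
  e (iter a.+1 p x) (iter a p x).
Proof.
move=> lx lea; have la := lev_iter_parent lx (ltnW lea).
by have [] := parP (x := iter a p x); rewrite ?la //; lia.
Qed.

Lemma path_up x a : lev x = i -> a <= i -> path e x (traject p (p x) a).
Proof.
move=> lx; elim: a => // a IHa lea.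
rewrite trajectSr rcons_path IHa ?(ltnW lea) //= last_traject -iterSr esym.
exact: ancestor_edge.
Qed.

Lemma path_down x a : lev x = i -> a <= i ->
  path e (iter a p x) (rev (traject p x a)).
Proof.
move=> lx lea; have := path_up lx lea.
have <- : belast x (traject p (p x) a) = traject p x a.
  by elim: a x {lx lea} => // a IHa x /=; rewrite IHa.
rewrite -(last_traject p x a) rev_path; apply: sub_path => y z; by rewrite esym.
Qed.

Lemma mem_traject_lev x a y : lev x = i -> a <= i ->
  y \in traject p (p x) a -> exists b, [/\ 0 < b <= a, lev y = i - b & y = iter b p x].
Proof.
move=> lx lea /trajectP[b ltb ->]; exists b.+1.
rewrite -iterSr; split => //; apply: lev_iter_parent => //; exact: leq_trans ltb lea.
Qed.

Lemma uniq_traject_lev x a : lev x = i -> a <= i -> uniq (traject p (p x) a).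
Proof.
move=> lx; elim: a => // a IHa lea; rewrite trajectSr rcons_uniq IHa ?(ltnW lea) // andbT.
apply/negP => /(mem_traject_lev lx (ltnW lea)) [b [lb]].
rewrite -iterSr lev_iter_parent //; lia.
Qed.

(* Take the highest generation m at which two neighbours u2, u3 of a common
   upper vertex w still have different ancestors, and a third neighbour u1 of w.
   A path from u1 to z of the right length closes up through the tree with u2 or with u3, since
   the ancestor of z cannot agree with both. *)
Lemma layer_cycle : S != set0 -> 2 * l <= D -> 0 < i < l ->
  exists s, [/\ size s = 2 * l, uniq s & cycle e s].
Proof.
case/set0Pn => x0 Sx0 leD /andP[i_gt0 ltil].
have nSi : i.+1 <> i by lia.
have reflI : i.*2.+1 - i = i.+1 by lia.
have reflS : i.*2.+1 - i.+1 = i by lia.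
have up x y : x \in S -> y \in S -> e x y -> lev x = i -> lev y = i.+1.
  by move=> Sx Sy /(bipS Sx Sy) nxy lx; case: (levS Sy) => // ly; rewrite lx ly eqxx in nxy.
have down x y : x \in S -> y \in S -> e x y -> lev x = i.+1 -> lev y = i.
  by move=> Sx Sy /(bipS Sx Sy) nxy lx; case: (levS Sy) => // ly; rewrite lx ly eqxx in nxy.
have nbr x Z : x \in S -> size Z < D -> exists y, [/\ y \in S, e x y & y \notin Z].
  move=> Sx ltZ; have [|q [qp sq _ Sq nq]] := greedy_path (q := 1) (Z := Z) minS Sx.
    by rewrite addn1.
  case: q qp sq Sq nq => // y [] //= /andP[exy _] _ Sq nq; exists y; split => //.
    by rewrite Sq ?mem_head.
  by have := nq y (mem_head _ _); rewrite inE negb_or => /andP[].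
pose P m := [exists w in S, exists u in S, exists u' in S,
  [&& lev w == i.+1, e w u, e w u' & iter m p u != iter m p u']].
have exP : exists m, P m.
  have [w Sw lw] : exists2 w, w \in S & lev w = i.+1.
    case: (levS Sx0) => l0; last by exists x0.
    have [|y [Sy exy _]] := nbr x0 [::] Sx0; first by rewrite /=; lia.
    by exists y => //; exact: up exy l0.
  have [|u [Su eu _]] := nbr w [::] Sw; first by rewrite /=; lia.
  have [|u' [Su' eu' nu]] := nbr w [:: u] Sw; first by rewrite /=; lia.
  exists 0; apply/exists_inP; exists w => //; apply/exists_inP; exists u => //.
  by apply/exists_inP; exists u'; rewrite // lw eqxx eu eu' eq_sym -(mem_seq1 u').
(* Above the root [p] is unconstrained, but [iter (a - i) p r] no longer depends on [u]; so [P m]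
   fails for [i <= m] and a largest [m] exists. *)
have iter_root u a : lev u = i -> i <= a -> iter a p u = iter (a - i) p r.
  move=> lu lea; rewrite -{1}(subnK lea) iterD; congr (iter _ _ _).
  by apply: lev0; rewrite lev_iter_parent // subnn.
have boundP m : P m -> m <= i.-1.
  case/exists_inP => w Sw /exists_inP[u Su] /exists_inP[u' Su'] /and4P[/eqP lw eu eu' nuu].
  suff: ~~ (i <= m) by lia.
  apply: contra nuu => leim.
  by rewrite (iter_root u) ?(iter_root u') //; [exact: down eu' lw | exact: down eu lw].
have [m Pm maxm] := ex_maxnP exP boundP.
have lem := boundP m Pm.
have ltmi : m < i by clear -lem i_gt0; lia.
have lemi := ltnW ltmi.
case/exists_inP: Pm => w Sw /exists_inP[u2 Su2] /exists_inP[u3 Su3] /and4P[/eqP lw e2 e3 n23].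
have lu2 := down _ _ Sw Su2 e2 lw; have lu3 := down _ _ Sw Su3 e3 lw.
(* Maximality of [m]: the lower neighbours of one upper vertex share their ancestor of order
   [m.+1]. *)
have sameanc v u u' : v \in S -> u \in S -> u' \in S -> lev v = i.+1 -> e v u -> e v u' ->
    iter m.+1 p u = iter m.+1 p u'.
  move=> Sv Su Su' lv eu eu'; apply/eqP; apply: contraT => nuu.
  suff /maxm : P m.+1 by rewrite ltnn.
  apply/exists_inP; exists v => //; apply/exists_inP; exists u => //.
  by apply/exists_inP; exists u' => //; rewrite lv eqxx eu eu'.
have [|u1 [Su1 e1 nu1]] := nbr w [:: u2; u3] Sw; first by rewrite /=; lia.
have lu1 := down _ _ Sw Su1 e1 lw.
(* The cycle will consist of [u], [w], [u1], the path [q], [m.+1] ancestors of [z] and [m] ancestors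
   of [u]: this adds up to [2 * l]. The even length of [q] brings [z] back to layer [i]. *)
have [|q [qp sq uq Sq nq]] :=
  greedy_path (q := (l - m.+2).*2) (Z := [:: w; u2; u3]) minS Su1; first by rewrite /=; lia.
set z := last u1 q.
have Sz : z \in S by have := mem_last u1 q; rewrite -/z inE => /predU1P[->|/Sq].
pose c := iter m.+1 p u1.
have [lz cz] : lev z = i /\ iter m.+1 p z = c.
  (* A path in [S] alternates between the layers ([i.*2.+1 - lev x] is the other layer), and
     [sameanc] carries the ancestor [c] across each upper vertex. *)
  have walk : forall s x, path e x s -> {subset s <= S} -> x \in S ->
      (lev x = i -> iter m.+1 p x = c) ->
      (lev x = i.+1 -> {in S, forall y, e x y -> iter m.+1 p y = c}) ->
      (lev (last x s) = if odd (size s) then (i.*2.+1 - lev x) else lev x) /\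
      (lev (last x s) = i -> iter m.+1 p (last x s) = c).
    elim=> [|y s IHs] x //= /andP[exy pys] Ss Sx Hi Hi1.
    have Sy : y \in S by rewrite Ss ?mem_head.
    have Ss' : {subset s <= S} by move=> t ts; rewrite Ss // inE ts orbT.
    have [||] := IHs y pys Ss' Sy.
    - case: (levS Sx) => lx ly; first by case: nSi; rewrite -(up _ _ Sx Sy exy lx).
      exact: Hi1.
    - move=> ly t St eyt; case: (levS Sx) => lx; last by case: nSi; rewrite -ly; exact: down lx.
      rewrite -(Hi lx); apply: (sameanc y) => //; by rewrite esym.
    move=> -> H; split => //; case: (levS Sx) => lx.
      by rewrite (up _ _ Sx Sy exy lx) lx reflI reflS; case: (odd _).
    by rewrite (down _ _ Sx Sy exy lx) lx reflI reflS; case: (odd _).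
  have [//||] := walk q u1 qp Sq Su1; first by rewrite lu1 => /eqP; rewrite eqn_leq ltnn andbF.
  by rewrite sq odd_double lu1 => lz cz; split => //; exact: cz.
have [u [Su eu lu nz /andP[nu uw]]] : exists u, [/\ u \in S, e w u, lev u = i,
    iter m p u != iter m p z & (u != u1) && (u \notin q)].
  have nq2 : u2 \notin q by apply/negP => /nq; rewrite !inE eqxx !orbT.
  have nq3 : u3 \notin q by apply/negP => /nq; rewrite !inE eqxx !orbT.
  move: nu1; rewrite !inE negb_or ![u1 == _]eq_sym => /andP[nu12 nu13].
  have [e2z|] := eqVneq (iter m p u2) (iter m p z); last by exists u2; rewrite nu12.
  by exists u3; rewrite -e2z eq_sym nu13.
have cu : iter m.+1 p u = c by exact: (sameanc w).
have wq : w \notin q by apply/negP => /nq; rewrite !inE eqxx !orbT.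
have u1q : u1 \notin q by apply/negP => /nq; rewrite !inE eqxx.
exists ([:: u, w, u1 & q] ++ traject p (p z) m.+1 ++ rev (traject p (p u) m)).
split.
- rewrite !size_cat size_rev !size_traject /= sq; clear -lem ltil i_gt0; lia.
- rewrite cat_uniq; apply/and3P; split.
  + rewrite /= uq u1q !inE !negb_or wq nu uw /= !andbT.
    apply/andP; split; apply/eqP => uw'; case: nSi; first by rewrite -lw -uw'.
    by rewrite -lw uw'.
  + apply/hasPn => y; rewrite mem_cat mem_rev => yin.
    have ly : lev y < i.
      by case/orP: yin => [/(mem_traject_lev lz ltmi)|/(mem_traject_lev lu lemi)] [b [lb -> _]];
        clear -lb i_gt0 ltmi; lia.
    apply/negP => yS; have : y \in S.
      by move: yS; rewrite !inE => /or4P[/eqP->|/eqP->|/eqP->|/Sq].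
    by case/levS => ly'; rewrite ly' in ly; clear -ly; lia.
  rewrite cat_uniq rev_uniq !uniq_traject_lev // andbT.
  apply/hasPn => y; rewrite mem_rev => yu; apply/negP => yz.
  have [b [lb lyb yb]] := mem_traject_lev lu lemi yu.
  have [a [la lya ya]] := mem_traject_lev lz ltmi yz.
  (* A common vertex of the two branches has the same order [b <= m] in both, by its level; the
     ancestors of order [m] would then agree, against the choice of [u]. *)
  have ab : a = b by clear -lb la lya lyb ltmi; lia.
  case/eqP: nz; rewrite (_ : m = (m - b) + b); last by clear -lb; lia.
  by rewrite !iterD -yb -ab -ya.
- rewrite -[cycle e _]/(path e u
    (rcons ([:: w, u1 & q] ++ traject p (p z) m.+1 ++ rev (traject p (p u) m)) u)).
  rewrite !rcons_cat -rev_cons -trajectS !cat_path -[last u _]/z last_traject cz -cu.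
  by rewrite path_up // path_down // /= esym eu e1 qp.
Qed.
End LayerCycle.

(** * Breadth-first layers of a bipartite graph *)

Section Bfs.
Variables (e : rel T) (f : T -> bool) (W : {set T}) (r : T) (l : nat).
Hypothesis esym : symmetric e.
Hypothesis bip : forall x y, e x y -> f x != f y.
Hypothesis Wr : r \in W.

Fixpoint bfs_ball i : {set T} :=
  if i is j.+1 then bfs_ball j :|: [set y in W | [exists x in bfs_ball j, e x y]]
  else [set r].

(* The value l.+1 stands for all distances larger than l. *)
Definition bfs_level x := find (fun i => x \in bfs_ball i) (iota 0 l.+1).

(** The default [x] is never taken at levels 1 to [l], where a neighbour one level lower exists. *)
Definition bfs_parent x := odflt x [pick y | e y x && (bfs_level y == (bfs_level x).-1)].

Lemma bfs_levelE x i : i <= l -> (bfs_level x <= i) = (x \in bfs_ball i).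
Proof.
move=> leil; rewrite -ltnS -has_take_leq ?size_iota // take_iota (minn_idPl _) //.
apply/hasP/idP => [[j]|xi]; last by exists i; rewrite // mem_iota /= add0n.
rewrite mem_iota add0n => /andP[_ leji]; elim: i leji {leil} => [|i IHi].
  by rewrite ltnS leqn0 => /eqP->.
rewrite ltnS leq_eqVlt => /predU1P[->//|/IHi IH xj]; by rewrite /= inE IH.
Qed.

Lemma bfs_level_edge x y : y \in W -> e x y -> bfs_level x < l ->
  bfs_level y <= (bfs_level x).+1.
Proof.
move=> Wy exy ltx; rewrite bfs_levelE //= !inE Wy; apply/orP; right.
by apply/exists_inP; exists x => //; rewrite -bfs_levelE // ltnW.
Qed.

Lemma bfs_sub x : bfs_level x <= l -> x \in W.
Proof.
rewrite bfs_levelE //; elim: l => [|i IHi] /=; first by rewrite inE => /eqP->.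
by rewrite !inE => /orP[/IHi|/andP[]].
Qed.

Lemma bfs_parentP x : 0 < bfs_level x <= l ->
  e (bfs_parent x) x /\ bfs_level (bfs_parent x) = (bfs_level x).-1.
Proof.
case lx: (bfs_level x) => [//|a] /= leal.
rewrite /bfs_parent lx; case: pickP => [y /andP[eyx /eqP ly]|] //= none; exfalso.
have : x \in bfs_ball a.+1 by rewrite -bfs_levelE // lx.
have nxa : x \notin bfs_ball a by rewrite -bfs_levelE ?lx ?ltnn // ltnW.
rewrite /= inE (negPf nxa) /= inE => /andP[Wx /exists_inP[y ya eyx]].
have := none y; rewrite eyx /= eqn_leq bfs_levelE ?(ltnW leal) // ya /= => /negbT.
rewrite -ltnNge => ltya.
have: bfs_level x <= a; last by rewrite lx ltnn.
apply: (leq_trans (bfs_level_edge Wx eyx _) ltya); exact: leq_trans ltya (ltnW leal).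
Qed.

Lemma bfs_level0 x : bfs_level x = 0 -> x = r.
Proof. by move=> lx; apply/set1P; rewrite -[[set r]]/(bfs_ball 0) -bfs_levelE ?lx. Qed.

(** Colours alternate along the chain of parents down to [r]; this is what excludes edges inside a
    layer. *)
Lemma bfs_color x : bfs_level x <= l -> f x = f r (+) odd (bfs_level x).
Proof.
have [a] := ubnP (bfs_level x); elim: a x => // a IHa x lta lex.
case lx: (bfs_level x) => [|b]; first by rewrite (bfs_level0 lx) addbF.
have [|epx lpx] := bfs_parentP (x := x); first by rewrite lex andbT lx.
rewrite lx /= in lpx; rewrite lx in lta lex; have := bip epx.
rewrite IHa lpx //; last by rewrite ltnW.
by rewrite /= addbN; case: (f x); case: (_ (+) _).
Qed.

Lemma bfs_level_neq x y : bfs_level x <= l -> bfs_level y <= l -> e x y ->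
  bfs_level x != bfs_level y.
Proof.
move=> lx ly /bip; rewrite (bfs_color lx) (bfs_color ly); apply: contraNneq => ->; exact: eqxx.
Qed.

Let L (i : nat) := [set x | bfs_level x == i].
Let E (i : nat) := \sum_(x in L i) #|[set y in L i.+1 | e x y]|.

Lemma bfs_layer0 : L 0 = [set r].
Proof.
apply/setP => x; rewrite !inE; apply/eqP/eqP => [/bfs_level0//|->].
by apply/eqP; rewrite -leqn0 bfs_levelE // set11.
Qed.

(** If the edges between the two layers are too many, some part of their union has minimum degree
    above [2 * l] and [layer_cycle] applies to it. *)
Lemma bfs_layer_edges i : i < l ->
  (exists s, [/\ size s = 2 * l, uniq s & cycle e s]) \/
  E i <= 2 * l * (#|L i| + #|L i.+1|).
Proof.
(* Layer 0 is only the root, with at most [#|L 1|] edges; [layer_cycle] handles positive [i]. *)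
case: i => [|i] lil.
  right; apply: (@leq_trans #|L 1|); last by rewrite mulnDr -[leqLHS]add0n leq_add // leq_pmull ?muln_gt0.
  apply: (@leq_trans (\sum_(x in [set r]) #|L 1|)); last by rewrite big_set1.
  rewrite /E bfs_layer0.
  by apply: leq_sum => x _; apply: subset_leq_card; apply/subsetP => y; rewrite !inE => /andP[].
have [|lt_E] := leqP (E i.+1) _; [by right | left].
have disL : [disjoint L i.+1 & L i.+2].
  by apply/pred0P => x /=; rewrite !inE; case: eqP => //= ->; rewrite eqn_leq ltnn andbF.
have [|S sS [S0 minS]] := min_degree_subset (U := L i.+1 :|: L i.+2) (D := 2 * l) esym.
  rewrite cardsU disjoint_setI0 // cards0 subn0.
  (* Each edge between the layers is counted from both of its ends. *)
  apply: (@leq_trans (2 * E i.+1)); first by nia.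
  rewrite mul2n -addnn /edges_in (eq_bigl [in [predU L i.+1 & L i.+2]]); last first.
    by move=> x; rewrite !inE.
  rewrite bigU //=; apply: leq_add.
    apply: leq_sum => x _; apply: subset_leq_card; apply/subsetP => y.
    by rewrite !inE => /andP[-> ->]; rewrite orbT.
  apply: (@leq_trans (\sum_(x in L i.+2) #|[set y in L i.+1 | e x y]|)).
    rewrite /E; under eq_bigr do rewrite -sum1dep_card.
    under [leqRHS]eq_bigr do rewrite -sum1dep_card.
    rewrite (exchange_big_dep (mem (L i.+2))) /=; last by move=> x y _ /andP[].
    apply: leq_sum => y Ly; rewrite leq_eqVlt; apply/orP; left; apply/eqP.
    by apply: eq_bigl => x; rewrite Ly esym.
  apply: leq_sum => x _; apply: subset_leq_card; apply/subsetP => y.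
  by rewrite !inE => /andP[-> ->].
have levS : {in S, forall x, bfs_level x = i.+1 \/ bfs_level x = i.+2}.
  by move=> x /(subsetP sS); rewrite !inE => /orP[]/eqP; [left|right].
apply: (layer_cycle (lev := bfs_level) (p := bfs_parent) (r := r) (i := i.+1) (D := 2 * l) (S := S)) => //.
- by move=> x /andP[? lx]; apply: bfs_parentP; rewrite (leq_trans lx (ltnW lil)) andbT.
- exact: bfs_level0.
- move=> x y Sx Sy; apply: bfs_level_neq.
    by case: (levS x Sx) => ->; rewrite // ltnW.
  by case: (levS y Sy) => ->; rewrite // ltnW.
Qed.

(** Without the cycle, consecutive layer sizes a, b, c satisfy (t + 3) b <= a + 2 b + c by the
    degrees in the middle layer. As a <= b inductively, t b <= c: layers grow by the factor [t] and
    layer [l] would outgrow [T]. *)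
Lemma even_cycle_min_degree t : 0 < l -> 0 < t -> #|T| < t ^ l ->
  {in W, forall x, 2 * l * (t + 3) <= #|[set y in W | e x y]|} ->
  exists s, [/\ size s = 2 * l, uniq s & cycle e s].
Proof.
move=> l_gt0 t_gt0 ltT minW.
have [[i [lil ltE]]|allE] : (exists i, i < l /\ 2 * l * (#|L i| + #|L i.+1|) < E i) \/
    (forall i, i < l -> E i <= 2 * l * (#|L i| + #|L i.+1|)).
  have [/existsP[i lti]|] := boolP [exists i : 'I_l, 2 * l * (#|L i| + #|L i.+1|) < E i].
    by left; exists i.
  by move=> /existsPn H; right => i lil; rewrite leqNgt (H (Ordinal lil)).
  by case: (bfs_layer_edges lil) => //; rewrite leqNgt ltE.
have L0 := bfs_layer0.
have degL i x : x \in L i.+1 -> i.+1 < l ->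
    #|[set y in W | e x y]| <= #|[set y in L i | e x y]| + #|[set y in L i.+2 | e x y]|.
  rewrite inE => /eqP lx lil; apply: leq_trans (leq_card_setU _ _).
  apply: subset_leq_card; apply/subsetP => y; rewrite !inE => /andP[Wy exy]; rewrite exy !andbT.
  have ly : bfs_level y <= i.+2 by rewrite -lx; apply: bfs_level_edge => //; rewrite lx.
  have lx' : bfs_level x <= (bfs_level y).+1.
    have [lty|] := ltnP (bfs_level y) l; last by move=> lley; rewrite lx; clear -lley lil; lia.
    by apply: bfs_level_edge => //; [rewrite bfs_sub // lx ltnW | rewrite esym].
  have : bfs_level x != bfs_level y.
    by apply: bfs_level_neq => //; rewrite ?lx; [exact: ltnW | exact: leq_trans ly lil].
  by rewrite lx in lx' *; clear -lx' ly; lia.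
have degE i : i.+1 < l -> 2 * l * (t + 3) * #|L i.+1| <= E i + E i.+1.
  move=> lil.
  have -> : E i = \sum_(x in L i.+1) #|[set y in L i | e x y]|.
    rewrite /E; under eq_bigr do rewrite -sum1dep_card.
    under [RHS]eq_bigr do rewrite -sum1dep_card.
    rewrite (exchange_big_dep (mem (L i.+1))) /=; last by move=> x y _ /andP[].
    by apply: eq_bigr => y Ly; apply: eq_bigl => x; rewrite Ly esym.
  rewrite /E -big_split /= mulnC -sum_nat_const; apply: leq_sum => x Lx.
  apply: leq_trans (degL i x Lx lil); apply: minW; apply: bfs_sub.
  by move: Lx; rewrite inE => /eqP ->; exact: ltnW.
have grow i : i < l -> t * #|L i| <= #|L i.+1|.
  elim: i => [|i IHi] lil.
    rewrite L0 cards1 muln1; apply: (@leq_trans (#|[set y in W | e r y]|)).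
      by apply: leq_trans (minW r Wr); clear -l_gt0; nia.
    apply: subset_leq_card; apply/subsetP => y; rewrite !inE => /andP[Wy ery].
    have lr : bfs_level r = 0 by apply/eqP; rewrite -leqn0 bfs_levelE // set11.
    have : bfs_level y <= 1 by rewrite -lr; apply: bfs_level_edge => //; rewrite lr.
    rewrite leq_eqVlt ltnS leqn0 => /predU1P[->//|/eqP /bfs_level0 yr].
    by have := bip ery; rewrite yr eqxx.
  have IH := IHi (ltnW lil); have := degE i lil.
  have := allE i (ltnW lil); have := allE i.+1 lil.
  move: (#|L i|) (#|L i.+1|) (#|L i.+2|) IH => a b c; clear -t_gt0 l_gt0.
  move=> leab le1 le2 le3.
  have lea : a <= b by nia.
  have : 2 * l * (t * b) <= 2 * l * c by nia.
  by rewrite leq_pmul2l ?muln_gt0.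
have : t ^ l <= #|L l|.
  have H : forall i, i <= l -> t ^ i <= #|L i|.
    elim=> [|i IHi] lil; first by rewrite L0 cards1.
    by rewrite expnS; apply: leq_trans (grow i lil); rewrite leq_mul2l IHi ?orbT // ltnW.
  exact: H.
move=> le_tL; have := leq_trans ltT le_tL.
by rewrite ltnNge max_card.
Qed.

End Bfs.

(** Bondy-Simonovits: pass to a bipartite subgraph keeping half of the edges, then to a subset of
    large minimum degree. The two losses cost [8 * l * (t + 3)], at most [32 * l * t]. *)
Theorem even_cycle_edges e l t : symmetric e -> irreflexive e ->
  0 < l -> 0 < t -> #|T| < t ^ l ->
  ~ (exists s, [/\ size s = 2 * l, uniq s & cycle e s]) ->
  \sum_x \sum_y e x y <= 32 * l * t * #|T|.
Proof.
move=> esym eirr l_gt0 t_gt0 ltT nocyc; rewrite leqNgt; apply/negP => lt_e.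
have [f le_f] := half_edges_cross esym eirr.
pose e' x y := e x y && (f x != f y).
have e'sym : symmetric e' by move=> x y; rewrite /e' esym eq_sym.
have [|W _ [/set0Pn[r Wr] minW]] := min_degree_subset (U := setT) (D := 2 * l * (t + 3)) e'sym.
  have -> : edges_in e' setT = \sum_x \sum_y e' x y.
    rewrite /edges_in; apply: eq_big => [x|x _]; first by rewrite inE.
    rewrite -sum1dep_card big_mkcond; apply: eq_bigr => y _; rewrite inE /=.
    by case: (e' x y).
  rewrite cardsT -(ltn_pmul2l (isT : 0 < 2)).
  apply: leq_trans le_f; apply: leq_ltn_trans lt_e.
  rewrite mulnA leq_mul2r; nia.
apply: nocyc; have [x y|x Wx|s [ss us cs]] :=
  even_cycle_min_degree (f := f) e'sym _ Wr l_gt0 t_gt0 ltT.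
- by case/andP.
- exact/ltnW/minW.
exists s; split => //; case: s cs {ss us} => //= x s.
by apply: sub_path => y z /andP[].
Qed.

(* Each labelled triangle abc has at most one common neighbour on ab or at most
   two on bc: otherwise further apexes d over ab and f over bc give the
   5-cycle a d b f c. *)
Lemma triangles_without_pentagon e : symmetric e -> irreflexive e ->
  ~ (exists s, [/\ size s = 5, uniq s & cycle e s]) ->
  \sum_a \sum_b \sum_c ([&& e a b, e b c & e c a] : nat) <= 3 * #|T| ^ 2.
Proof.
move=> esym eirr nocyc.
pose N a b := [set c | e a c && e c b].
have neq x y : e x y -> x != y by apply: contraTneq => ->; rewrite eirr.
have sparse a b c : [&& e a b, e b c & e c a] -> (#|N a b| <= 1) || (#|N b c| <= 2).
  case/and3P => eab ebc eca; apply/negbNE; rewrite negb_or -!ltnNge; apply/negP => /andP[gt1 gt2].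
  have /subsetPn[d] : ~~ (N a b \subset [set c]).
    by apply: contraL gt1 => /subset_leq_card; rewrite cards1 -leqNgt.
  rewrite !inE => /andP[ead edb] ndc.
  have /subsetPn[f] : ~~ (N b c \subset [set a; d]).
    apply: contraL gt2 => /subset_leq_card le2; rewrite -leqNgt; apply: leq_trans le2 _.
    by rewrite cards2; case: (a != d).
  rewrite !inE negb_or => /andP[ebf efc] /andP[nfa nfd].
  apply: nocyc; exists [:: a; d; b; f; c]; split => //; last by rewrite /= ead edb ebf efc eca.
  rewrite /= !inE !negb_or (neq _ _ ead) (neq _ _ eab) (eq_sym a f) nfa (eq_sym a c) (neq _ _ eca).
  by rewrite (neq _ _ edb) (eq_sym d f) nfd ndc (neq _ _ ebf) (neq _ _ ebc) (neq _ _ efc).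
have apex a b : \sum_c ([&& e a b, e b c & e c a] : nat) <= #|N a b|.
  rewrite -sum1_card [leqRHS]big_mkcond; apply: leq_sum => c _; rewrite inE.
  by rewrite [e a c]esym [e c b]esym; case: (e a b); case: (e b c); case: (e c a).
(* A triangle is charged to the pair [a], [b], which takes at most one, or to [b], [c], which takes
   at most two; hence the constant 1 + 2. *)
pose t1 a b c := (#|N a b| <= 1) && [&& e a b, e b c & e c a].
pose t2 a b c := (#|N b c| <= 2) && [&& e a b, e b c & e c a].
have -> : 3 * #|T| ^ 2 = \sum_(a : T) \sum_(b : T) 1 + \sum_(b : T) \sum_(c : T) 2.
  rewrite !sum_nat_const -mulnn; clear; set n := #|T|; nia.
apply: (@leq_trans (\sum_a \sum_b \sum_c (t1 a b c + t2 a b c))).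
  do 3!(apply: leq_sum => ? _); rewrite /t1 /t2.
  by case tri: [&& _, _ & _] => //; case/orP: (sparse _ _ _ tri) => -> //; rewrite addnS.
have -> : \sum_a \sum_b \sum_c (t1 a b c + t2 a b c) =
    \sum_a \sum_b \sum_c t1 a b c + \sum_a \sum_b \sum_c t2 a b c.
  rewrite -big_split; apply: eq_bigr => a _; rewrite -big_split; apply: eq_bigr => b _.
  by rewrite -big_split.
apply: leq_add.
  apply: leq_sum => a _; apply: leq_sum => b _; rewrite /t1.
  case: (leqP #|N a b| 1) => [le1|_] /=; last by rewrite big1.
  exact: leq_trans (apex a b) le1.
rewrite exchange_big; apply: leq_sum => b _; rewrite exchange_big; apply: leq_sum => c _ /=.
rewrite /t2; case: (leqP #|N b c| 2) => [le2|_] /=; last by rewrite big1.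
apply: leq_trans le2; apply: leq_trans (apex b c).
by apply: leq_sum => a _; rewrite andbC -andbA.
Qed.

(** Cauchy-Schwarz for the degrees and again for the codegrees bounds [s ^ 4] by [#|T| ^ 4] times
    the number of closed walks of length 4. Those with [x = z] and those with [y = w] number at most
    [#|T| * s] each. *)
Lemma four_cycle_count e s : symmetric e -> \sum_x \sum_y (e x y : nat) = s ->
  s ^ 4 <= #|T| ^ 4 * (\sum_x \sum_y \sum_z \sum_w
    ([&& e x y, e y z, e z w, e w x, x != z & y != w] : nat) + 2 * #|T| * s).
Proof.
move=> esym sdef; set nd := \sum_x _.
pose d y := \sum_x (e x y : nat); pose cod x z := \sum_y (e x y * e y z).
have sE : s = \sum_y d y by rewrite -sdef exchange_big.
have d2 : \sum_y d y ^ 2 = \sum_x \sum_z cod x z.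
  under [RHS]eq_bigr do rewrite exchange_big.
  rewrite [RHS]exchange_big; apply: eq_bigr => y _ /=.
  rewrite -mulnn /d big_distrl; apply: eq_bigr => x _ /=.
  by rewrite big_distrr; apply: eq_bigr => z _ /=; rewrite [e z y]esym.
have cauchy1 : s ^ 2 <= #|T| * \sum_x \sum_z cod x z.
  by rewrite sE -d2; exact: sum_nat_sqr_le.
have cauchy2 : (\sum_x \sum_z cod x z) ^ 2 <= #|T| ^ 2 * \sum_x \sum_z cod x z ^ 2.
  rewrite (pair_bigA _ cod) (pair_bigA _ (fun x z => cod x z ^ 2)) /=.
  have := sum_nat_sqr_le predT (fun u : T * T => cod u.1 u.2).
  by rewrite card_prod mulnn; apply.
have hom : \sum_x \sum_z cod x z ^ 2 <= nd + 2 * #|T| * s.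
  have -> : \sum_x \sum_z cod x z ^ 2 =
      \sum_x \sum_y \sum_z \sum_w (e x y * e y z * (e z w * e w x)).
    apply: eq_bigr => x _; rewrite [RHS]exchange_big; apply: eq_bigr => z _ /=.
    rewrite -mulnn /cod big_distrl; apply: eq_bigr => y _ /=.
    rewrite big_distrr; apply: eq_bigr => w _ /=.
    by rewrite [e z w]esym [e w x]esym; congr (_ * _); rewrite mulnC.
  have -> : 2 * #|T| * s = \sum_x \sum_y \sum_(z : T) (e x y : nat)
      + \sum_x \sum_y \sum_(z : T) (e x y : nat).
    have -> : \sum_x \sum_y \sum_(z : T) (e x y : nat) = #|T| * s.
      rewrite -sdef big_distrr /=; apply: eq_bigr => x _; rewrite big_distrr /=.
      by apply: eq_bigr => y _; rewrite sum_nat_const.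
    lia.
  rewrite /nd -!big_split /=; apply: leq_sum => x _.
  rewrite -!big_split /=; apply: leq_sum => y _.
  have split4 z w : (e x y * e y z * (e z w * e w x) <=
      [&& e x y, e y z, e z w, e w x, x != z & y != w] +
      ((x == z) * e x y + (y == w) * e x y))%N.
    have [<-|_] := eqVneq x z; have [<-|_] := eqVneq y w;
      by case: (e x y) => //; case: (e y _) => //; case: (e _ w) => //; case: (e _ _) => //; case: (e _ _).
  have delta (u : T) c : \sum_v (u == v) * c = c.
    rewrite (bigD1 u) //= eqxx mul1n big1 ?addn0 // => v nvu.
    by rewrite eq_sym (negPf nvu).
  have {1}-> : \sum_(z : T) (e x y : nat) = \sum_z \sum_(w : T) (x == z) * e x y.
    by rewrite exchange_big; apply: eq_bigr => z _; rewrite delta.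
  rewrite -!big_split /=; apply: leq_sum => z _.
  rewrite -[X in _ + (_ + X)](delta y) -!big_split /=; apply: leq_sum => w _.
  exact: split4.
rewrite (expnM s 2 2); apply: leq_trans (_ : (#|T| * \sum_x \sum_z cod x z) ^ 2 <= _).
  by rewrite leq_exp2r.
rewrite expnMn (expnD #|T| 2 2) -mulnA leq_mul2l; apply/orP; right.
by apply: leq_trans cauchy2 _; rewrite leq_mul2l hom orbT.
Qed.

End Graph.

(** * Links in the cube *)

Section Toggle.
Variable T : finType.
Implicit Types (A : {set T}) (c d : T).

Definition tog A c : {set T} := [set y | (y \in A) (+) (y == c)].

Lemma in_tog A c y : (y \in tog A c) = (y \in A) (+) (y == c).
Proof. by rewrite inE. Qed.

Lemma togK c : involutive (tog^~ c).
Proof. by move=> A; apply/setP => y; rewrite !in_tog -addbA addbb addbF. Qed.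

Lemma togC A c d : tog (tog A c) d = tog (tog A d) c.
Proof. by apply/setP => y; rewrite !in_tog addbAC. Qed.

Lemma tog_inj A : injective (tog A).
Proof.
move=> c d /setP/(_ c); rewrite !in_tog eqxx.
by case: (c \in A) => /=; case: eqP.
Qed.

Lemma sum_tog c (phi : {set T} -> nat) : \sum_A phi (tog A c) = \sum_A phi A.
Proof. by rewrite [RHS](reindex_inj (can_inj (togK c))). Qed.

Lemma card_tog A c :
  (c \in A /\ #|A| = #|tog A c|.+1) \/ (c \notin A /\ #|tog A c| = #|A|.+1).
Proof.
case cA: (c \in A); [left | right]; split => //.
  rewrite (cardsD1 c) cA add1n; congr _.+1; apply: eq_card => y.
  by rewrite !inE; have [->|] := eqVneq y c; rewrite ?cA ?addbF.
rewrite (cardsD1 c) in_tog cA eqxx add1n; congr _.+1; apply: eq_card => y.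
by rewrite !inE; have [->|] := eqVneq y c; rewrite ?cA ?addbF.
Qed.

End Toggle.

Lemma hasCycleI k m (F : {set vtx k * vtx k}) (s : seq (vtx k)) :
  size s = m -> uniq s -> cycle (adjF F) s -> hasCycle m F.
Proof.
move=> /eqP ss us cs; apply/existsP; exists (Tuple ss).
by rewrite /= us cs.
Qed.

Lemma hasCycleP k m (F : {set vtx k * vtx k}) : hasCycle m F ->
  exists s : seq (vtx k), [/\ size s = m, uniq s & cycle (adjF F) s].
Proof. by case/existsP => s /andP[us cs]; exists s; rewrite size_tuple. Qed.

Lemma bin_below_middle k : 'C(2 * k + 1, k.-1) <= 'C(2 * k + 1, k).
Proof.
case: k => [|k] //; rewrite -(leq_pmul2l (ltn0Sn k)) mul_bin_left leq_mul2r.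
by apply/orP; right; lia.
Qed.

(** [S] is the total size of the links and [M] a central binomial coefficient. [M * S] contributes
    64 and the diagonal term [2 * f * M] contributes 2; halving gives 33. *)
Lemma cycle4l_arith (S n M f l t m : nat) : 0 < l -> 0 < t -> m <= n ->
  S <= 2 * M * (32 * l * t * n) -> f <= M * m -> 2 * f ^ 2 <= M * (S + 2 * f) ->
  f ^ 2 <= 33 * l * t * n * M ^ 2.
Proof.
move=> l_gt0 t_gt0 lemn tot lef H.
have H1 : f * M <= l * t * n * M ^ 2.
  have lt1 : 1 <= l * t by nia.
  have -> : l * t * n * M ^ 2 = l * t * (n * M * M) by rewrite -mulnn; lia.
  have : f * M <= n * M * M by rewrite leq_mul2r; nia.
  nia.
have H2 : M * S <= 64 * (l * t * n * M ^ 2).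
  have -> : 64 * (l * t * n * M ^ 2) = M * (2 * M * (32 * l * t * n)) by rewrite -mulnn; lia.
  by rewrite leq_mul2l tot orbT.
have -> : 33 * l * t * n * M ^ 2 = 33 * (l * t * n * M ^ 2) by rewrite !mulnA.
move: (l * t * n * M ^ 2) H1 H2 H => X; rewrite mulnDr; lia.
Qed.

(** Inserting [81 * G <= 54 * P + 27 * H] cancels both [G] and [P], and the convexity hypothesis
    then eliminates [Q]. *)
Lemma cycle10_arith (k G P Q H f M : nat) : 0 < k -> 3 * G <= 2 * P + H ->
  54 * P + 36 * k.+1 * Q <=
    81 * G + k * (9 * Q + 12 * k.+1 * (2 * f) + 2 * M * (4 * k.+1 ^ 2)) +
    (54 * Q + 36 * k.+1 * (2 * f)) ->
  12 * k.+1 * (2 * f) <= 9 * Q + 2 * M * (4 * k.+1 ^ 2) ->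
  H <= 12 * M * (2 * k + 1) ^ 2 -> f <= M * k.+1 ->
  48 * k * f <= (32 * k + 1400) * (M * k.+1).
Proof.
case: k => // k _ leG main conv leH lef.
have leH' : H <= 48 * (M * k.+2 ^ 2) by apply: leq_trans leH _; rewrite -!mulnn; nia.
(* [k] is now one less than in the statement; the coefficient left on [Q] is 36 (k + 2) - 9 (k + 1)
   - 54 = 9 (3 k + 1). *)
have conv' := leq_mul (leqnn (3 * k + 1)) conv.
have step : k.+2 * (48 * k * f) <= k.+2 * (72 * f + (32 * k + 1312) * (M * k.+2)).
  move: leG main conv' leH'; rewrite -!mulnn; clear; nia.
move: step; rewrite leq_pmul2l // => step.
clear -step lef; nia.
Qed.

Lemma reverse_path (T : eqType) (e : rel T) (v u : T) (R : seq T) : symmetric e ->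
  path e u (rcons R v) -> path e v (rcons (rev R) u).
Proof.
move=> esym; rewrite -rev_cons -{2}(last_rcons u R v) -(belast_rcons u R v) rev_path.
by apply: sub_path => y z; rewrite esym.
Qed.

(** Dropping the common edge leaves two paths between its ends; one is run backwards to [u], the
    other onwards to [v]. *)
Lemma glue_cycles (T : eqType) (e : rel T) (v u : T) (R R' : seq T) : symmetric e ->
  cycle e [:: v, u & R] -> cycle e [:: v, u & R'] -> cycle e (v :: rev R ++ u :: R').
Proof.
move=> esym /= /andP[_ pR] /andP[_ pR'].
by rewrite -cat_rcons rcons_cat cat_path reverse_path //= last_rcons.
Qed.

(** * Lifting cycles of links, and degree counts *)

Section Cube.
Variables (k : nat) (F : {set vtx k * vtx k}).
Implicit Types (A B v x : vtx k) (a b c d i j : 'I_(2 * k + 1)).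

Lemma adjF_sym : symmetric (adjF F).
Proof. by move=> A B; rewrite /adjF orbC. Qed.

Definition E A c := adjF F A (tog A c).

Lemma E_tog A c : E (tog A c) c = E A c.
Proof. by rewrite /E togK adjF_sym. Qed.

Definition lnk x : rel 'I_(2 * k + 1) :=
  fun i j => [&& i != j, E (tog x i) j & E (tog x j) i].

Lemma lnk_sym x : symmetric (lnk x).
Proof. by move=> i j; rewrite /lnk eq_sym andbCA andbC -andbA. Qed.

Lemma lnk_irr x : irreflexive (lnk x).
Proof. by move=> i; rewrite /lnk eqxx. Qed.

(** The vertices x^i, x^ij, x^j, and so on, over a path of the link. A closed cycle needs one vertex
    more, put in front by [lift_cycle_uniq]. *)
Fixpoint lift_path x i (p : seq 'I_(2 * k + 1)) : seq (vtx k) :=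
  if p is j :: p' then [:: tog x i, tog (tog x i) j & lift_path x j p'] else [:: tog x i].

Lemma lift_pathP x i p y c : y \in lift_path x i p -> c \notin i :: p ->
  (c \in y) = (c \in x).
Proof.
elim: p i => [|j p IHp] i /=.
  by rewrite !inE => /eqP-> /negPf nci; rewrite in_tog nci addbF.
rewrite !inE !negb_or => /or3P[/eqP->|/eqP->|/IHp IH] /and3P[/negPf nci /negPf ncj ncp];
  rewrite ?in_tog ?nci ?ncj ?addbF //.
by apply: IH; rewrite inE negb_or ncj.
Qed.

Lemma lift_path_uniq x i p : uniq (i :: p) -> uniq (lift_path x i p).
Proof.
elim: p i => [|j p IHp] i //= /andP[ni /[dup] up /IHp /= ->].
have nij : i != j by apply: contraNneq ni => ->; rewrite mem_head.
have xi y : y \in lift_path x j p -> (i \in y) = (i \in x) by move=> /lift_pathP ->.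
rewrite andbT !inE negb_or -andbA; apply/and3P; split.
- apply/eqP => /setP/(_ j); rewrite [RHS]in_tog eqxx; by case: (j \in _).
- by apply/negP => /xi; rewrite in_tog eqxx; case: (i \in x).
- by apply/negP => /xi; rewrite !in_tog eqxx (negPf nij) addbF; case: (i \in x).
Qed.

Lemma lift_path_size x i p : size (lift_path x i p) = (size p).*2.+1.
Proof. by elim: p i => //= j p IHp i; rewrite IHp. Qed.

Lemma lnk_adj x i j : lnk x i j ->
  adjF F (tog x i) (tog (tog x i) j) /\ adjF F (tog (tog x i) j) (tog x j).
Proof. by case/and3P => _ Eij Eji; split; rewrite // togC adjF_sym. Qed.

Lemma lift_path_path x i p z : path (lnk x) i p ->
  adjF F z (tog x i) -> path (adjF F) z (lift_path x i p).
Proof.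
elim: p i z => [|j p IHp] i z /=; first by move=> _ ->.
by case/andP => /lnk_adj[e1 e2] pp -> /=; rewrite e1 IHp.
Qed.

Lemma last_lift_path x i p z : last z (lift_path x i p) = tog x (last i p).
Proof. by elim: p i z => //= j p IHp i z; rewrite IHp. Qed.

(** Three directions are the least possible: with only two, the closing vertex would be x^ij a
    second time. *)
Lemma lift_cycle_uniq x i p : 1 < size p -> uniq (i :: p) ->
  uniq (tog (tog x (last i p)) i :: lift_path x i p).
Proof.
move=> sp /[dup] up /= /andP[ni _]; rewrite lift_path_uniq // andbT.
case: p sp up ni => [|j [|j' p]] //= _ up ni.
set z := last j' p.
have zp : z \in j' :: p by exact: mem_last.
have zi : z != i by apply: contraNneq ni => <-; rewrite inE zp orbT.
have zj : z != j by case/and3P: up => _ + _; apply: contraNneq => <-.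
rewrite 2!in_cons 2!negb_or; apply/and3P; split.
- by apply/eqP => /setP/(_ z); rewrite !in_tog eqxx (negPf zi); case: (z \in x).
- apply/eqP => /setP/(_ z); rewrite !in_tog eqxx (negPf zi) (negPf zj).
  by case: (z \in x).
- apply/negP => yin; have := lift_pathP (p := j' :: p) yin ni.
  by rewrite !in_tog eqxx (eq_sym i) (negPf zi); case: (i \in x).
Qed.

Lemma lift_cycle_cycle x i p : cycle (lnk x) (i :: p) ->
  cycle (adjF F) (tog (tog x (last i p)) i :: lift_path x i p).
Proof.
rewrite /= rcons_path => /andP[pp /lnk_adj[e1 e2]].
by rewrite rcons_path lift_path_path //= last_lift_path; exact: e1.
Qed.

Lemma lift_cycle x s : 2 < size s -> uniq s -> cycle (lnk x) s ->
  hasCycle (2 * size s) F.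
Proof.
case: s => [|i p] // sp up cp.
apply: (@hasCycleI _ _ _ (tog (tog x (last i p)) i :: lift_path x i p)).
- by rewrite /= lift_path_size [RHS]mul2n doubleS.
- exact: lift_cycle_uniq.
- exact: lift_cycle_cycle.
Qed.

Definition deg A := \sum_c (E A c : nat).

Hypothesis sF : F \subset dO_edges k.

Lemma edgeP A B : (A, B) \in F ->
  exists2 c, c \notin A & [/\ B = tog A c, #|A| = k & #|B| = k.+1].
Proof.
move/(subsetP sF); rewrite inE /= => /and3P[/eqP cA /eqP cB sAB].
have /cards1P[c cBA] : #|B :\: A| == 1 by rewrite cardsD (setIidPr sAB) cA cB; lia.
have /setDP[cinB cnA] : c \in B :\: A by rewrite cBA set11.
exists c => //; split => //; apply/setP => y; rewrite in_tog.
have [->|nyc] := eqVneq y c; first by rewrite cinB (negPf cnA).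
rewrite addbF; apply/idP/idP; last exact: (subsetP sAB).
move=> yB; apply: contraR nyc => yA; rewrite -in_set1 -cBA; exact/setDP.
Qed.

Lemma E_card A c : E A c -> c \notin A /\ #|A| = k \/ c \in A /\ #|A| = k.+1.
Proof.
case/orP => /edgeP[d ndA [eqA cA cB]].
  by left; rewrite (tog_inj eqA).
have cd : c = d.
  apply/eqP; have /setP/(_ c) := eqA; rewrite !in_tog eqxx.
  by case: (c \in A); case: (c == d).
by right; split => //; move: ndA; rewrite -cd in_tog eqxx; case: (c \in A).
Qed.

Lemma card_F_tog : \sum_A \sum_c (((A, tog A c) \in F) : nat) = #|F|.
Proof.
rewrite pair_bigA -sum1_card /=.
have inj : injective (fun u : vtx k * 'I_(2 * k + 1) => (u.1, tog u.1 u.2)).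
  by move=> [A c] [B d] [/= <- /tog_inj ->].
rewrite -big_mkcond /= -(big_imset (fun _ => 1) (in2W inj)) /=.
apply: eq_bigl => -[A B]; apply/imsetP/idP => [[[A' c] /= + [-> ->]]|] //.
move=> AB; have [c _ [eqB _ _]] := edgeP AB.
by exists (A, c); rewrite ?unfold_in /= -?eqB.
Qed.

(** Each edge is seen from both ends; the two storage orders exclude each other, as a member of [F]
    has the smaller set first. *)
Lemma sum_deg : \sum_A deg A = 2 * #|F|.
Proof.
rewrite [RHS]mul2n -addnn -{1}card_F_tog.
have -> : #|F| = \sum_A \sum_c (((tog A c, A) \in F) : nat).
  rewrite -card_F_tog exchange_big [RHS]exchange_big; apply: eq_bigr => c _ /=.
  by rewrite -(sum_tog c); apply: eq_bigr => A _; rewrite togK.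
rewrite -big_split; apply: eq_bigr => A _; rewrite -big_split; apply: eq_bigr => c _ /=.
rewrite /E /adjF; case i1: (_ \in F); case i2: (_ \in F) => //.
have [d _ [_ c1 c2]] := edgeP i1; have [d' _ [_ c1' c2']] := edgeP i2; lia.
Qed.

Let N := 'C(2 * k + 1, k).

Definition mid : {set vtx k} := [set A : vtx k | (#|A| == k) || (#|A| == k.+1)].

Lemma card_mid : #|mid| = 2 * N.
Proof.
have -> : mid = [set A : vtx k | #|A| == k] :|: [set A : vtx k | #|A| == k.+1].
  by apply/setP => A; rewrite !inE.
rewrite cardsU disjoint_setI0 ?cards0 ?subn0; last first.
  by apply/pred0P => A /=; rewrite !inE; case: eqP => //= ->; lia.
rewrite !card_draws card_ord -/N -[X in _ + X]bin_sub; last lia.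
by rewrite (_ : _ - _ = k) -/N; lia.
Qed.

Lemma deg_mid A : A \notin mid -> deg A = 0.
Proof.
rewrite inE negb_or => /andP[/eqP n1 /eqP n2]; rewrite /deg big1 // => c _.
by case EA: (E A c) => //; case: (E_card EA) => [] [].
Qed.

Lemma deg_le A : deg A <= k.+1.
Proof.
have [|/deg_mid->//] := boolP (A \in mid); rewrite inE => /orP[]/eqP cA.
  apply: (@leq_trans (\sum_(c in ~: A) 1)); last first.
    by rewrite sum1_card; have := cardsC A; rewrite card_ord cA; lia.
  rewrite [leqRHS]big_mkcond; apply: leq_sum => c _; rewrite inE.
  by case EA: (E A c) => //; case: (E_card EA) => [] [H]; rewrite ?H // cA; lia.
rewrite -cA -sum1_card [leqRHS]big_mkcond; apply: leq_sum => c _.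
by case EA: (E A c) => //; case: (E_card EA) => [] [H]; rewrite ?H // cA; lia.
Qed.

Lemma sum_mid (phi : vtx k -> nat) : (forall A, A \notin mid -> phi A = 0) ->
  \sum_A phi A = \sum_(A in mid) phi A.
Proof.
move=> phi0; rewrite [RHS]big_mkcond; apply: eq_bigr => A _.
by case: ifPn => // /phi0.
Qed.

Lemma sum_deg_sqr : 2 * #|F| ^ 2 <= N * \sum_A deg A ^ 2.
Proof.
have H : (2 * #|F|) ^ 2 <= 2 * N * \sum_A deg A ^ 2.
  rewrite -sum_deg !sum_mid ?card_mid; last 2 first.
  - by move=> A /deg_mid->.
  - by move=> A /deg_mid->.
  by rewrite -card_mid; exact: sum_nat_sqr_le.
rewrite -(leq_pmul2l (isT : 0 < 2)); move: H; rewrite expnMn; lia.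
Qed.

(* The vertices with a nonempty link. *)
Definition far : {set vtx k} := [set x : vtx k | (#|x|.+1 == k) || (#|x| == k.+2)].

(** Complementation identifies the layers k - 1 and k + 2, and neither is larger than a middle
    layer. *)
Lemma card_far : #|far| <= 2 * N.
Proof.
have -> : far = [set A : vtx k | #|A|.+1 == k] :|: [set A : vtx k | #|A| == k.+2].
  by apply/setP => A; rewrite !inE.
apply: leq_trans (leq_card_setU _ _) _; rewrite [leqRHS]mul2n -addnn.
have le1 : 'C(2 * k + 1, k.-1) <= N := bin_below_middle k.
apply: leq_add.
  apply: leq_trans le1; rewrite -[X in 'C(X, _)]card_ord -card_draws.
  by apply: subset_leq_card; apply/subsetP => A; rewrite !inE => /eqP cA; rewrite -[X in _ == X.-1]cA.
rewrite card_draws card_ord.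
case: (posnP k) => [k0|k_gt0]; first by rewrite bin_small // k0.
rewrite -bin_sub; last lia.
by rewrite (_ : _ - _ = k.-1) //; lia.
Qed.

(** The ends of the path x^i, x^ij, x^j have equal size, so [i] and [j] are both inside or both
    outside [x]. *)
Lemma lnk_far x i j : lnk x i j -> x \in far.
Proof.
case/and3P => nij /E_card Eij /E_card Eji; rewrite inE.
have nji : j != i by rewrite eq_sym.
move: Eij Eji; rewrite !in_tog (negPf nij) (negPf nji) !addbF.
have [[xi ci]|[/negPf xi ci]] := card_tog x i; have [[xj cj]|[/negPf xj cj]] := card_tog x j;
  rewrite xi xj /=; move=> [] [H1 H2] [] [H3 H4] //;
  move: ci cj H2 H4; clear; move: #|x| #|tog x i| #|tog x j| => a b c; lia.
Qed.

(** Rebasing at the midpoint x^ij turns a link edge into an ordered pair of distinct edges of [F] at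
    one vertex; the pairs of equal edges give [2 * #|F|]. *)
Lemma sum_lnk : \sum_x \sum_i \sum_j (lnk x i j : nat) + 2 * #|F| = \sum_A deg A ^ 2.
Proof.
have -> : \sum_x \sum_i \sum_j (lnk x i j : nat) =
    \sum_A \sum_i \sum_j ((i != j) * (E A i * E A j)).
  rewrite exchange_big [RHS]exchange_big; apply: eq_bigr => i _ /=.
  rewrite exchange_big [RHS]exchange_big; apply: eq_bigr => j _ /=.
  rewrite -(sum_tog i) -(sum_tog j); apply: eq_bigr => A _.
  rewrite /lnk togK (togC (tog A j) i j) togK !E_tog; by case: (i != j); case: (E A i); case: (E A j).
rewrite -sum_deg -big_split; apply: eq_bigr => A _ /=.
rewrite -mulnn /deg big_distrl -big_split; apply: eq_bigr => i _ /=.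
rewrite big_distrr /= (bigD1 i) //= [RHS](bigD1 i) //= eqxx mul0n add0n addnC.
congr (_ + _); first by rewrite mulnb andbb.
by apply: eq_bigr => j nji; rewrite eq_sym nji mul1n.
Qed.

Lemma card_F_le : #|F| <= N * k.+1.
Proof.
have : 2 * #|F| <= 2 * N * k.+1.
  rewrite -sum_deg sum_mid => [|A]; last exact: deg_mid.
  rewrite -card_mid -sum_nat_const; apply: leq_sum => A _; exact: deg_le.
by rewrite -mulnA leq_pmul2l.
Qed.

Lemma cycle4l_bound l t : 1 < l -> 0 < t -> 2 * k + 1 < t ^ l ->
  ~~ hasCycle (4 * l) F -> #|F| ^ 2 <= 33 * l * t * (2 * k + 1) * N ^ 2.
Proof.
move=> l_gt1 t_gt0 ltn nocyc.
have link_le x : \sum_i \sum_j (lnk x i j : nat) <= 32 * l * t * (2 * k + 1).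
  suff: \sum_i \sum_j (lnk x i j : nat) <= 32 * l * t * #|'I_(2 * k + 1)| by rewrite card_ord.
  apply: even_cycle_edges => //.
  - exact: lnk_sym.
  - exact: lnk_irr.
  - exact: ltnW.
  - by rewrite card_ord.
  case=> s [ss us cs]; case/negP: nocyc.
  rewrite (_ : 4 * l = 2 * size s); last by rewrite ss mulnA.
  by apply: (lift_cycle _ us cs); rewrite ss; lia.
have tot : \sum_x \sum_i \sum_j (lnk x i j : nat) <= 2 * N * (32 * l * t * (2 * k + 1)).
  apply: (@leq_trans (\sum_(x in far) 32 * l * t * (2 * k + 1))).
    rewrite [leqRHS]big_mkcond; apply: leq_sum => x _; case: ifPn => // nx.
    rewrite big1 // => i _; rewrite big1 // => j _.
    by case lij: (lnk x i j) => //; rewrite (lnk_far lij) in nx.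
  by rewrite sum_nat_const leq_mul2r card_far orbT.
have := sum_deg_sqr; rewrite -sum_lnk; have := card_F_le.
move=> leF le2; apply: (cycle4l_arith _ t_gt0 _ tot leF le2); lia.
Qed.

(** * Decagons: walk counts and the density 2/3 *)

Section Pentagon.

(** Walks of length two from [v] by the direction of their second step; the walk that turns back,
    with [c = j], is included. *)
Let g v j := \sum_c E v c * E (tog v c) j.
Let P := \sum_v \sum_i E v i * (deg v * deg (tog v i)).
(** The closed walk v, v^i, v^id, v^ijd, v^jd, v^j, with coinciding directions allowed. *)
Let hex v i j d := E v i * E v j *
  (E (tog v i) d * E (tog (tog v i) d) j * (E (tog v j) d * E (tog (tog v j) d) i)).
Let Hex := \sum_v \sum_i \sum_j \sum_d hex v i j d.

(** Rebased at v^i, such a walk becomes two walks of length two from one vertex whose last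
    directions are both [j]. *)
Lemma sum_walk4 :
  \sum_v \sum_i \sum_j \sum_d
    E v i * E v j * (E (tog v i) d * E (tog (tog v i) d) j) = \sum_v \sum_j g v j ^ 2.
Proof.
transitivity (\sum_v \sum_i \sum_j \sum_d
    E v i * E (tog v i) j * (E v d * E (tog v d) j)).
  rewrite exchange_big [RHS]exchange_big; apply: eq_bigr => i _ /=.
  rewrite -(sum_tog i); apply: eq_bigr => v _.
  apply: eq_bigr => j _; apply: eq_bigr => d _.
  by rewrite togK E_tog.
apply: eq_bigr => v _; rewrite exchange_big; apply: eq_bigr => j _ /=.
rewrite -mulnn big_distrl; apply: eq_bigr => i _ /=.
by rewrite big_distrr.
Qed.

Lemma sum_walk3 :
  \sum_v \sum_i \sum_j \sum_d E v i * E v j * E (tog v i) d = P.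
Proof.
apply: eq_bigr => v _; apply: eq_bigr => i _.
rewrite /deg big_distrl big_distrr; apply: eq_bigr => j _ /=.
by rewrite !big_distrr; apply: eq_bigr => d _ /=; rewrite mulnA.
Qed.

Lemma sum_walk4' :
  \sum_v \sum_i \sum_j \sum_d
    E v i * E v j * (E (tog v i) d * E (tog v j) d) = \sum_v \sum_d g v d ^ 2.
Proof.
apply: eq_bigr => v _.
transitivity (\sum_d \sum_i \sum_j E v i * E v j * (E (tog v i) d * E (tog v j) d)).
  rewrite [RHS]exchange_big; apply: eq_bigr => i _; exact: exchange_big.
apply: eq_bigr => d _; rewrite -mulnn big_distrl; apply: eq_bigr => i _ /=.
by rewrite big_distrr; apply: eq_bigr => j _ /=; rewrite mulnACA.
Qed.

(* Pointwise, with z_i = E v^i d and e_ij = z_i * E v^id j: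
   e_ij + e_ji + z_i z_j <= z_i + z_j + e_ij e_ji. *)
Lemma sum_g_sqr : 3 * \sum_v \sum_j g v j ^ 2 <= 2 * P + Hex.
Proof.
have swap (phi : vtx k -> 'I_(2 * k + 1) -> 'I_(2 * k + 1) -> 'I_(2 * k + 1) -> nat) :
    \sum_v \sum_i \sum_j \sum_d phi v i j d = \sum_v \sum_i \sum_j \sum_d phi v j i d.
  by apply: eq_bigr => v _; rewrite exchange_big.
have -> : 3 * \sum_v \sum_j g v j ^ 2 =
  (\sum_v \sum_i \sum_j \sum_d E v i * E v j * (E (tog v i) d * E (tog (tog v i) d) j) +
   \sum_v \sum_i \sum_j \sum_d E v j * E v i * (E (tog v j) d * E (tog (tog v j) d) i)) +
   \sum_v \sum_i \sum_j \sum_d E v i * E v j * (E (tog v i) d * E (tog v j) d).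
  rewrite -(swap (fun v i j d => E v i * E v j * (E (tog v i) d * E (tog (tog v i) d) j))).
  by rewrite sum_walk4 sum_walk4'; lia.
have -> : 2 * P =
  \sum_v \sum_i \sum_j \sum_d E v i * E v j * E (tog v i) d +
  \sum_v \sum_i \sum_j \sum_d E v j * E v i * E (tog v j) d.
  rewrite -(swap (fun v i j d => E v i * E v j * E (tog v i) d)) sum_walk3; lia.
rewrite /Hex -!big_split; apply: leq_sum => v _ /=.
rewrite -!big_split; apply: leq_sum => i _ /=.
rewrite -!big_split; apply: leq_sum => j _ /=.
rewrite -!big_split; apply: leq_sum => d _ /=; rewrite /hex.
by case: (E v i); case: (E v j); case: (E (tog v i) d); case: (E (tog v j) d);
  case: (E _ j); case: (E _ i).
Qed.

Lemma sum_deg_nbr : \sum_v \sum_j g v j = \sum_v deg v ^ 2.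
Proof.
transitivity (\sum_v \sum_c E v c * deg (tog v c)).
  apply: eq_bigr => v _; rewrite exchange_big; apply: eq_bigr => c _ /=.
  by rewrite -big_distrr.
rewrite exchange_big; under eq_bigr => c _.
  rewrite -(sum_tog c); under eq_bigr do rewrite E_tog togK.
over.
rewrite exchange_big; apply: eq_bigr => v _ /=.
by rewrite -big_distrl /= mulnn.
Qed.

Lemma sum_deg_g : \sum_v deg v * \sum_j g v j = P.
Proof.
apply: eq_bigr => v _; rewrite exchange_big big_distrr; apply: eq_bigr => c _ /=.
by rewrite -big_distrr /= -/(deg _) mulnCA.
Qed.

(* The directions other than c in which a neighbour v^c of v has edges. *)
Let J v : {set 'I_(2 * k + 1)} := if #|v| == k then v else ~: v.

Lemma card_J v : v \in mid -> #|J v| = k.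
Proof.
rewrite inE /J; case: eqP => [//|_] /= /eqP cv.
by have := cardsC v; rewrite card_ord cv; clear; move: #|~: v| => a; lia.
Qed.

(** The second step undoes the change of size made by the first, so its direction lies in [J v]
    unless it reverses the first step. *)
Lemma g_off v j : v \in mid -> j \notin J v -> g v j = E v j.
Proof.
move=> vmid njJ; rewrite /g (bigD1 j) //= E_tog mulnb andbb big1 ?addn0 // => c ncj.
apply/eqP; rewrite mulnb eqb0; apply/negP => /andP[/E_card Evc /E_card].
rewrite in_tog eq_sym (negPf ncj) addbF.
have := card_tog v c; move: Evc njJ; rewrite /J.
case: eqP => cv; rewrite ?inE; move=> [] [H1 H2] H3 [] [H4 H5] [] [H6 H7];
  rewrite ?H1 ?H6 ?(negPf H3) // in H4 H6 *; lia.
Qed.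

Lemma sum_g_on v : v \in mid -> \sum_(j in J v) g v j + deg v = \sum_j g v j.
Proof.
move=> vmid; rewrite [RHS](bigID (mem (J v))) /=; congr (_ + _).
rewrite /deg [LHS](bigID (mem (J v))) /= big1 ?add0n; last first.
  move=> j; rewrite /J; case: eqP => cv jJ; apply/eqP; rewrite eqb0; apply/negP => /E_card.
    by rewrite jJ cv => -[] [] // _; lia.
  by move: jJ; rewrite inE => /negPf ->; case=> -[].
by apply: eq_bigr => j njJ; rewrite g_off.
Qed.

(** A hexagon with three distinct directions is a triangle in the link of v^ij, and a pentagon in a
    link would lift to a decagon. Repeated directions cost at most [3 * ((2 * k + 1) * (2 * #|F|))],
    which doubling the constant absorbs. *)
Lemma hex_le : ~~ hasCycle 10 F -> Hex <= 12 * N * (2 * k + 1) ^ 2.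
Proof.
move=> nocyc.
pose tri x i j d : nat := [&& lnk x i j, lnk x j d & lnk x d i].
have triangles x : \sum_i \sum_j \sum_d tri x i j d <= 3 * (2 * k + 1) ^ 2.
  suff: \sum_i \sum_j \sum_d tri x i j d <= 3 * #|'I_(2 * k + 1)| ^ 2 by rewrite card_ord.
  apply: triangles_without_pentagon; [exact: lnk_sym | exact: lnk_irr |].
  case=> s [ss us cs]; case/negP: nocyc.
  rewrite (_ : 10 = 2 * size s); last by rewrite ss.
  by apply: (lift_cycle _ us cs); rewrite ss.
have tri_tot : \sum_x \sum_i \sum_j \sum_d tri x i j d <= 2 * N * (3 * (2 * k + 1) ^ 2).
  apply: (@leq_trans (\sum_(x in far) 3 * (2 * k + 1) ^ 2)).
    rewrite [leqRHS]big_mkcond; apply: leq_sum => x _; case: ifPn => [_|nx]; first exact: triangles.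
    rewrite big1 // => i _; rewrite big1 // => j _; rewrite big1 // => d _.
    by rewrite /tri; case lij: (lnk x i j) => //; rewrite (lnk_far lij) in nx.
  by rewrite sum_nat_const leq_mul2r card_far orbT.
have triE : \sum_x \sum_i \sum_j \sum_d tri x i j d =
    \sum_v \sum_i \sum_j \sum_d tri (tog (tog v i) j) i j d.
  rewrite exchange_big [RHS]exchange_big; apply: eq_bigr => i _ /=.
  rewrite exchange_big [RHS]exchange_big; apply: eq_bigr => j _ /=.
  by rewrite -(sum_tog j) -(sum_tog i).
have aux (a b c d : nat) : [/\ a <= d + (a + b + c), a <= d + (b + a + c) & a <= d + (b + c + a)].
  split; lia.
have hex_tri v i j d : hex v i j d <= tri (tog (tog v i) j) i j d +
    ((i == j) * E v i + (i == d) * E v i + (j == d) * E v j).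
  have hexi : hex v i j d <= E v i by rewrite /hex; case: (E v i); case: (E v j); do 4!case: (E _ _).
  have hexj : hex v i j d <= E v j by rewrite /hex; case: (E v i); case: (E v j); do 4!case: (E _ _).
  have [_|nij] := eqVneq i j.
    by apply: leq_trans hexi _; rewrite mul1n; case: (aux (E v i) ((i == d) * E v i) ((j == d) * E v j) (tri (tog (tog v i) j) i j d)).
  have [_|nid] := eqVneq i d.
    by apply: leq_trans hexi _; rewrite mul1n; case: (aux (E v i) (false * E v i) ((j == d) * E v j) (tri (tog (tog v i) j) i j d)).
  have [_|njd] := eqVneq j d.
    by apply: leq_trans hexj _; rewrite mul1n; case: (aux (E v j) (false * E v i) (false * E v i) (tri (tog (tog v i) j) i j d)).
  rewrite !mul0n !addn0 /tri /lnk nij njd (eq_sym d i) nid /=.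
  rewrite togK (togC (tog v i) j i) togK !E_tog.
  rewrite /hex (togC (tog v i) j d) E_tog (togC v i d) (togC (tog v d) i j) E_tog (togC v j d).
  by case: (E v i); case: (E v j); do 4!case: (E _ _).
have delta (u : 'I_(2 * k + 1)) (c : nat) : \sum_w (u == w) * c = c.
  rewrite (bigD1 u) //= eqxx mul1n big1 ?addn0 // => w nwu.
  by rewrite eq_sym (negPf nwu).
have degen v : \sum_i \sum_j \sum_d
    ((i == j) * E v i + (i == d) * E v i + (j == d) * E v j) = 3 * ((2 * k + 1) * deg v).
  have sumc (c : nat) : \sum_(d : 'I_(2 * k + 1)) c = (2 * k + 1) * c.
    by rewrite sum_nat_const card_ord.
  transitivity (\sum_i ((2 * k + 1) * E v i + (2 * k + 1) * E v i + deg v)).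
    apply: eq_bigr => i _.
    transitivity (\sum_j ((2 * k + 1) * ((i == j) * E v i) + E v i + E v j)).
      by apply: eq_bigr => j _; rewrite !big_split /= sumc (delta i) (delta j).
    by rewrite !big_split /= sumc -big_distrr /= (delta i).
  rewrite !big_split /= sumc -!big_distrr /= -/(deg v).
  move: (deg v) => D; lia.
have : Hex <= 2 * N * (3 * (2 * k + 1) ^ 2) + 3 * ((2 * k + 1) * (2 * #|F|)).
  apply: leq_trans (leq_add tri_tot (leqnn _)); rewrite triE.
  have -> : 3 * ((2 * k + 1) * (2 * #|F|)) = \sum_v 3 * ((2 * k + 1) * deg v).
    by rewrite -!big_distrr /= sum_deg.
  rewrite -big_split; apply: leq_sum => v _; rewrite -degen -big_split.
  apply: leq_sum => i _; rewrite -big_split; apply: leq_sum => j _; rewrite -big_split.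
  by apply: leq_sum => d _; exact: hex_tri.
have := card_F_le; clear; move: Hex #|F| N => H f M lef leH; apply: leq_trans leH _.
rewrite -mulnn; nia.
Qed.

Lemma cycle10_bound : 0 < k -> ~~ hasCycle 10 F ->
  48 * k * #|F| <= (32 * k + 1400) * (N * k.+1).
Proof.
move=> k_gt0 nocyc.
pose G2 := \sum_v \sum_j g v j ^ 2; pose Q := \sum_v deg v ^ 2; pose m := k.+1.
have gsqr : 3 * G2 <= 2 * P + Hex := sum_g_sqr.
(* The first square of the identity: (9 g - b)^2 >= 0 with [b = 3 * deg v + 2 * m], summed over the
   [k] directions of [J v]; the remaining directions contribute [deg v]. *)
have amgm v : v \in mid -> 18 * (3 * deg v + 2 * m) * \sum_j g v j <=
    81 * \sum_j g v j ^ 2 + k * (3 * deg v + 2 * m) ^ 2 + 18 * (3 * deg v + 2 * m) * deg v.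
  move=> vmid; rewrite -sum_g_on // mulnDr leq_add2r.
  set b := 3 * deg v + 2 * m.
  apply: (@leq_trans (\sum_(j in J v) (81 * g v j ^ 2 + b ^ 2))).
    rewrite big_distrr; apply: leq_sum => j _ /=.
    by have := (nat_Cauchy (9 * g v j) b).1; clear; clearbody b; move: (g v j) b => x y; rewrite -!mulnn; nia.
  rewrite big_split /= sum_nat_const card_J // leq_add2r -big_distrr leq_mul2l /=.
  by rewrite [leqRHS](bigID (mem (J v))) leq_addr.
have g0 v : v \notin mid -> \sum_j g v j = 0.
  move=> vmid; rewrite big1 // => j _; rewrite /g big1 // => c _.
  have : E v c <= deg v by rewrite /deg (bigD1 c) // leq_addr.
  by rewrite deg_mid // leqn0 => /eqP ->.
have sumQ : \sum_(v in mid) deg v ^ 2 = Q by rewrite -sum_mid // => v /deg_mid ->.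
have sumD : \sum_(v in mid) deg v = 2 * #|F| by rewrite -sum_mid ?sum_deg // => v /deg_mid.
have main : 54 * P + 36 * m * Q <=
    81 * G2 + k * (9 * Q + 12 * m * (2 * #|F|) + 2 * N * (4 * m ^ 2)) +
    (54 * Q + 36 * m * (2 * #|F|)).
  have -> : 54 * P + 36 * m * Q =
      \sum_(v in mid) 18 * (3 * deg v + 2 * m) * \sum_j g v j.
    rewrite -sum_mid => [|v /g0 ->]; last by rewrite muln0.
    rewrite -sum_deg_g /Q -sum_deg_nbr !big_distrr -big_split; apply: eq_bigr => v _ /=.
    by clear; clearbody m; move: (deg v) (\sum_j _) m => x y z; nia.
  apply: (@leq_trans (\sum_(v in mid) (81 * \sum_j g v j ^ 2 +
    k * (3 * deg v + 2 * m) ^ 2 + 18 * (3 * deg v + 2 * m) * deg v))).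
    by apply: leq_sum => v; exact: amgm.
  rewrite big_split /=; apply: leq_add; first rewrite big_split /=.
    apply: leq_add.
      rewrite -big_distrr leq_mul2l /= /G2 [leqRHS](bigID (mem mid)); exact: leq_addr.
    rewrite -big_distrr leq_mul2l; apply/orP; right.
    rewrite -sumQ -sumD -card_mid -sum_nat_const !big_distrr -!big_split /=.
    by apply: leq_sum => v _; clear; clearbody m; move: (deg v) m => x y; rewrite -!mulnn; nia.
  by rewrite -sumQ -sumD !big_distrr -!big_split /=; apply: leq_sum => v _; clear; clearbody m; move: (deg v) m => x y; rewrite -!mulnn; nia.
(* The second square: (3 deg v - 2 m)^2 >= 0, summed over [mid]. *)
have conv : 12 * m * (2 * #|F|) <= 9 * Q + 2 * N * (4 * m ^ 2).
  rewrite -sumQ -sumD -card_mid -sum_nat_const !big_distrr -!big_split /=.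
  apply: leq_sum => v _; have := (nat_Cauchy (3 * deg v) (2 * m)).1; clear.
  by clearbody m; move: (deg v) m => x y; rewrite -!mulnn; nia.
exact: cycle10_arith k_gt0 gsqr main conv (hex_le nocyc) card_F_le.
Qed.

End Pentagon.

End Cube.

(** * Hexagons *)


Lemma dO_edges_tog k (A : vtx k) c :
  ((A, tog A c) \in dO_edges k) = (#|A| == k) && (c \notin A).
Proof.
rewrite inE /=; case: (card_tog A c) => -[cA cc]; case: eqP => //= cardA.
  rewrite cA; apply/negP => /andP[/eqP cB _]; move: cB cc cardA.
  by clear; move: #|tog A c| #|A| => a b; lia.
rewrite cc cardA eqxx cA; apply/subsetP => y yA; rewrite in_tog yA.
by case: eqP => // yc; rewrite -yc yA in cA.
Qed.

Lemma e_dOE k : e_dO k = 'C(2 * k + 1, k) * k.+1.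
Proof.
rewrite /e_dO -(card_F_tog (subxx (dO_edges k))).
transitivity (\sum_(A : vtx k | #|A| == k) k.+1); last first.
  by rewrite sum_nat_cond_const card_draws card_ord.
rewrite [RHS]big_mkcond; apply: eq_bigr => A _; case: eqP => cA; last first.
  by rewrite big1 // => c _; rewrite dO_edges_tog; case: eqP.
transitivity (\sum_(c in ~: A) 1).
  rewrite [RHS]big_mkcond; apply: eq_bigr => c _.
  by rewrite dO_edges_tog cA eqxx inE; case: (c \in A).
rewrite sum1_card; have := cardsC A; rewrite card_ord cA; clear.
by move: #|~: A| => a; lia.
Qed.

Section Hexagon.
Variable k : nat.
Implicit Types (A x : vtx k) (a b c : 'I_(2 * k + 1)).

(** Labels the hexagon x^a, x^ab, x^b, x^bc, x^c, x^ca; the six orders of [a], [b], [c] bring each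
    of its edges to the position x^a, x^ab. *)
Let ok x a b c := [&& #|x|.+1 == k, a \notin x, b \notin x, c \notin x,
                      a != b, b != c & c != a].

(** For a given edge from A to A^b, [a] is any of the k elements of A and [c] any of the k elements
    outside A^b. *)
Lemma sum_hexagon_edge (H : {set vtx k * vtx k}) : H \subset dO_edges k ->
  \sum_x \sum_a \sum_b \sum_c (ok x a b c && ((tog x a, tog (tog x a) b) \in H) : nat)
  = k * k * #|H|.
Proof.
move=> sH.
transitivity (\sum_A \sum_b \sum_a \sum_c
    (ok (tog A a) a b c && ((A, tog A b) \in H) : nat)).
  rewrite exchange_big; under [RHS]eq_bigr do rewrite exchange_big.
  rewrite [RHS]exchange_big; apply: eq_bigr => a _ /=.
  by rewrite -(sum_tog a); apply: eq_bigr => A _; rewrite togK.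
rewrite -(card_F_tog sH) big_distrr; apply: eq_bigr => A _ /=.
rewrite big_distrr; apply: eq_bigr => b _ /=.
case AbH: (_ \in H); last first.
  by rewrite muln0 big1 // => a _; rewrite big1 // => c _; rewrite andbF.
have /andP[/eqP cA nbA] : (#|A| == k) && (b \notin A).
  by rewrite -dO_edges_tog (subsetP sH).
rewrite muln1; transitivity (\sum_(a in A) k); last by rewrite sum_nat_const cA.
rewrite [RHS]big_mkcond; apply: eq_bigr => a _ /=.
have [[aA ca]|[aA ca]] := card_tog A a; last first.
  by rewrite (negPf aA) big1 // => c _; rewrite /ok in_tog (negPf aA) eqxx /= andbF.
rewrite aA.
have cAb : #|~: tog A b| = k.
  have := cardsC (tog A b); have [[bA]|[_ ->]] := card_tog A b; first by rewrite bA in nbA.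
  by rewrite card_ord cA; clear; move: #|~: _| => d; lia.
rewrite -[RHS]cAb -sum1_card [RHS]big_mkcond; apply: eq_bigr => c _.
have nba : b != a by apply: contraNneq nbA => ->.
rewrite /ok -ca cA eqxx !inE aA eqxx (negPf nbA) (negPf nba) (eq_sym a b) nba (eq_sym b c) /=.
have [->|ncb] := eqVneq c b; first by rewrite (negPf nbA) !andbF.
by have [->|nca] := eqVneq c a; rewrite ?aA ?addbF ?andbT //=; case: (c \in A).
Qed.

Lemma cycle6_bound (F : {set vtx k * vtx k}) : 0 < k -> F \subset dO_edges k ->
  ~~ hasCycle 6 F -> 6 * #|F| <= 5 * e_dO k.
Proof.
move=> k_gt0 sF nocyc; pose H := dO_edges k :\: F.
have cH : #|H| = e_dO k - #|F| by rewrite cardsD (setIidPr sF).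
pose w x a b c : nat := ok x a b c && ((tog x a, tog (tog x a) b) \in H).
have okS x a b c : ok x b a c = ok x a b c.
  by rewrite /ok (eq_sym b a) (eq_sym a c) (eq_sym c b); do 7!case: (_ \in _) || case: (_ == _).
have okR x a b c : ok x b c a = ok x a b c.
  by rewrite /ok; do 7!case: (_ \in _) || case: (_ == _).
have swap (h : 'I_(2 * k + 1) -> 'I_(2 * k + 1) -> 'I_(2 * k + 1) -> nat) :
    \sum_a \sum_b \sum_c h b a c = \sum_a \sum_b \sum_c h a b c by rewrite exchange_big.
have rot (h : 'I_(2 * k + 1) -> 'I_(2 * k + 1) -> 'I_(2 * k + 1) -> nat) :
    \sum_a \sum_b \sum_c h b c a = \sum_a \sum_b \sum_c h a b c.
  rewrite exchange_big; apply: eq_bigr => b _ /=; exact: exchange_big.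
have okD x a b c : ok x a b c -> (tog x a, tog (tog x a) b) \in dO_edges k.
  case/and5P=> cx ax bx _ /andP[nab _]; rewrite dO_edges_tog.
  have [[a']|[_ ->]] := card_tog x a; first by rewrite a' in ax.
  by rewrite cx in_tog (negPf bx) (eq_sym b) (negPf nab).
(* If all six terms vanished, [a], [b], [c] would be a triangle in the link of [x] and lift to a
   hexagon of [F]. *)
have cover x a b c : ok x a b c ->
    0 < w x a b c + w x b a c + (w x b c a + w x c b a) + (w x c a b + w x a c b).
  move=> okx; rewrite lt0n; apply/negP; rewrite !addn_eq0.
  have okH p q r : ok x p q r -> w x p q r == 0 -> E F (tog x p) q.
    move=> okp; rewrite /w okp /= eqb0 inE (okD _ _ _ _ okp) andbT negbK.
    by rewrite /E /adjF => ->.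
  case/andP=> /andP[/andP[w1 w2] /andP[w3 w4]] /andP[w5 w6].
  have e1 := okH a b c okx w1.
  have e2 := okH b a c (etrans (okS x a b c) okx) w2.
  have e3 := okH b c a (etrans (okR x a b c) okx) w3.
  have e4 : E F (tog x c) b.
    by apply: (okH c b a) => //; rewrite okS okR.
  have e5 : E F (tog x c) a by apply: (okH c a b) => //; rewrite -okR.
  have e6 : E F (tog x a) c by apply: (okH a c b) => //; rewrite okS -okR.
  case/negP: nocyc; rewrite (_ : 6 = 2 * size [:: a; b; c]) //.
  case/and5P: okx => _ _ _ _ /and3P[nab nbc nca].
  apply: (@lift_cycle k F x) => //=.
    by rewrite !inE negb_or nab nbc (eq_sym a c) nca.
  by rewrite /lnk nab nbc nca e1 e2 e3 e4 e5 e6.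
have tot : \sum_x \sum_a \sum_b \sum_c (ok x a b c : nat) = k * k * e_dO k.
  rewrite -(sum_hexagon_edge (subxx _)); do 4!(apply: eq_bigr => ? _); congr nat_of_bool.
  by apply/esym/andb_idr; exact: okD.
have : k * k * e_dO k <= 6 * (k * k * #|H|).
  rewrite -tot -(sum_hexagon_edge (subsetDl _ _)) big_distrr; apply: leq_sum => x _ /=.
  pose W := \sum_a \sum_b \sum_c w x a b c.
  have T2 : \sum_a \sum_b \sum_c w x b a c = W by exact: swap.
  have T3 : \sum_a \sum_b \sum_c w x b c a = W by exact: rot.
  have T4 : \sum_a \sum_b \sum_c w x c b a = W by rewrite (rot (fun a b c => w x b a c)).
  have T5 : \sum_a \sum_b \sum_c w x c a b = W by rewrite (rot (fun a b c => w x b c a)).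
  have T6 : \sum_a \sum_b \sum_c w x a c b = W by rewrite (rot (fun a b c => w x c b a)).
  rewrite -/W (_ : 6 * W = W + W + (W + W) + (W + W)); last by lia.
  rewrite -{2}T2 -{2}T3 -{2}T4 -{2}T5 -{2}T6 {1}/W -!big_split.
  apply: leq_sum => a _; rewrite -!big_split; apply: leq_sum => b _; rewrite -!big_split.
  by apply: leq_sum => c _ /=; have := @cover x a b c; case: (ok x a b c) => // /(_ isT).
have sub : #|F| <= e_dO k := subset_leq_card sF.
rewrite mulnCA leq_pmul2l ?muln_gt0 ?k_gt0 // cH; lia.
Qed.
End Hexagon.

(** * Gluing octagons *)

Definition four_cycle (T : eqType) (e : rel T) (i j p q : T) : bool :=
  [&& e i j, e j p, e p q, e q i, i != p & j != q].

(* Octagons through the edge from v in direction j, listed as lifts of the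
   4-cycles i j p q of the link of tog v i. *)
Definition octagons k (F : {set vtx k * vtx k}) v j :=
  \sum_i \sum_p \sum_q (four_cycle (lnk F (tog v i)) i j p q : nat).

Lemma sum_octagons k (F : {set vtx k * vtx k}) :
  \sum_v \sum_j octagons F v j =
  \sum_x \sum_i \sum_j \sum_p \sum_q (four_cycle (lnk F x) i j p q : nat).
Proof.
under eq_bigr do rewrite exchange_big.
rewrite exchange_big [RHS]exchange_big; apply: eq_bigr => i _ /=.
by rewrite -(sum_tog i); apply: eq_bigr => x _; under eq_bigr do rewrite togK.
Qed.

Lemma sum_mem_inj (T : finType) (U : eqType) (f : T -> U) (Y : seq U) :
  injective f -> \sum_a (f a \in Y : nat) <= size Y.
Proof.
move=> finj; rewrite -big_mkcond sum1_card /= cardE -(size_map f).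
apply: uniq_leq_size; first by rewrite map_inj_uniq ?enum_uniq.
by move=> y /mapP[a + ->]; rewrite mem_enum.
Qed.

(** Since x^i is [v] and x^ij is [tog v j], these are the other six vertices of the octagon, in
    order from [tog v j] round to [v]. *)
Definition octagon_rest k (v : vtx k) i j p q : seq (vtx k) :=
  let x := tog v i in [:: tog x j; tog (tog x j) p; tog x p; tog (tog x p) q; tog x q; tog v q].

(** For each of the six vertices, hitting a given member of [Y] determines one of [i], [p], [q] from
    the other two, which spoils at most [(2 * k + 1) ^ 2] triples. *)
Lemma octagon_avoiding k (F : {set vtx k * vtx k}) v j (Y : seq (vtx k)) :
  6 * size Y * (2 * k + 1) ^ 2 < octagons F v j ->
  exists i p q, four_cycle (lnk F (tog v i)) i j p q /\ ~~ has [in Y] (octagon_rest v i j p q).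
Proof.
move=> ltY.
have [/existsP[i /existsP[p /existsP[q /andP[c4 dis]]]]|] := boolP [exists i, exists p, exists q,
    four_cycle (lnk F (tog v i)) i j p q && ~~ has [in Y] (octagon_rest v i j p q)].
  by exists i, p, q.
move=> none; exfalso; move: ltY; rewrite ltnNge => /negP; apply.
pose h (f : 'I_(2 * k + 1) -> 'I_(2 * k + 1) -> 'I_(2 * k + 1) -> vtx k) :=
  \sum_i \sum_p \sum_q (f i p q \in Y : nat).
have const (c : nat) : \sum_(d < 2 * k + 1) c = (2 * k + 1) * c.
  by rewrite sum_nat_const card_ord.
have hq f : (forall i p, injective (f i p)) -> h f <= size Y * (2 * k + 1) ^ 2.
  move=> finj; apply: (@leq_trans (\sum_(i < 2 * k + 1) \sum_(p < 2 * k + 1) size Y)).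
    by apply: leq_sum => i _; apply: leq_sum => p _; apply: sum_mem_inj.
  by rewrite !const -mulnn; nia.
have hp f : (forall i q, injective (fun p => f i p q)) -> h f <= size Y * (2 * k + 1) ^ 2.
  move=> finj; apply: leq_trans (hq (fun i q p => f i p q) finj).
  by apply: leq_sum => i _; rewrite exchange_big.
have hi f : (forall p q, injective (fun i => f i p q)) -> h f <= size Y * (2 * k + 1) ^ 2.
  move=> finj; apply: leq_trans (hp (fun p i q => f i p q) finj).
  by rewrite /h exchange_big.
have h1 := hi (fun i p q => tog (tog v i) j).
have h2 := hp (fun i p q => tog (tog (tog v i) j) p).
have h3 := hp (fun i p q => tog (tog v i) p).
have h4 := hq (fun i p q => tog (tog (tog v i) p) q).
have h5 := hq (fun i p q => tog (tog v i) q).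
have h6 := hq (fun i p q => tog v q).
have -> : 6 * size Y * (2 * k + 1) ^ 2 = size Y * (2 * k + 1) ^ 2 + (size Y * (2 * k + 1) ^ 2 +
   (size Y * (2 * k + 1) ^ 2 + (size Y * (2 * k + 1) ^ 2 + (size Y * (2 * k + 1) ^ 2 +
    size Y * (2 * k + 1) ^ 2)))) by rewrite -mulnA; move: (size Y * _) => Z; lia.
apply: leq_trans (leq_add (h1 _) (leq_add (h2 _) (leq_add (h3 _) (leq_add (h4 _)
  (leq_add (h5 _) (h6 _)))))); try by move=> *; apply: tog_inj.
  rewrite /octagons /h -!big_split; apply: leq_sum => i _; rewrite -!big_split.
  apply: leq_sum => p _; rewrite -!big_split; apply: leq_sum => q _ /=.
  case c4: (four_cycle _ _ _ _ _) => //.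
  move: none => /existsPn/(_ i)/existsPn/(_ p)/existsPn/(_ q); rewrite c4 /= negbK.
  by rewrite /octagon_rest /= orbF lt0n !addn_eq0 !eqb0 -!negb_or negbK.
by move=> _ _ i i'; rewrite ![tog (tog v _) j]togC => /tog_inj.
Qed.

Lemma octagon_glue k (F : {set vtx k * vtx k}) v j (R : seq (vtx k)) :
  cycle (adjF F) [:: v, tog v j & R] -> uniq [:: v, tog v j & R] ->
  6 * size R * (2 * k + 1) ^ 2 < octagons F v j -> hasCycle (size R + 8) F.
Proof.
move=> cR uR /octagon_avoiding[i [p [q [/and5P[lij ljp lpq lqi /andP[nip njq]] dis]]]].
have [nij _ _] := and3P lij; have [njp _ _] := and3P ljp.
have [npq _ _] := and3P lpq; have [nqi _ _] := and3P lqi.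
set x := tog v i in dis lij ljp lpq lqi.
have octE : tog (tog x (last i [:: j; p; q])) i :: lift_path x i [:: j; p; q] =
    rot 7 [:: v, tog v j & octagon_rest v i j p q].
  rewrite /= /rot /= {1 2 3}/x togK [tog (tog (tog v i) q) i]togC togK.
  by rewrite /octagon_rest.
have uO : uniq [:: v, tog v j & octagon_rest v i j p q].
  rewrite -(rot_uniq 7) -octE; apply: lift_cycle_uniq => //=.
  by rewrite !inE !negb_or nij nip (eq_sym i q) nqi njp njq npq.
have cO : cycle (adjF F) [:: v, tog v j & octagon_rest v i j p q].
  rewrite -(rot_cycle 7) -octE; apply: lift_cycle_cycle.
  by rewrite /= lij ljp lpq lqi.
apply: hasCycleI (glue_cycles (adjF_sym F) cO cR).
  by rewrite /= !addnS addn0.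
have perm (O : seq (vtx k)) :
    perm_eq (v :: rev O ++ tog v j :: R) ([:: v, tog v j & O] ++ R).
  by rewrite /= perm_cons -cat1s perm_catCA /= perm_cons perm_cat2r perm_rev.
rewrite (perm_uniq (perm _)) cat_uniq uO andTb.
have [nvR nuR uR'] : [/\ v \notin R, tog v j \notin R & uniq R].
  by move: uR; rewrite /= inE negb_or -andbA => /and4P[].
rewrite uR' andbT; apply/hasPn => y yR; apply/negP; rewrite inE => /predU1P[yv|].
  by rewrite -yv yR in nvR.
rewrite inE => /predU1P[yu|yO]; first by rewrite -yu yR in nuR.
by case/hasP: dis; exists y.
Qed.

Lemma E_mono k (F F' : {set vtx k * vtx k}) A c : F \subset F' -> E F A c -> E F' A c.
Proof. by move=> sF /orP[] /(subsetP sF) AcF; apply/orP; [left | right]. Qed.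

Lemma octagons_mono k (F F' : {set vtx k * vtx k}) v j :
  F \subset F' -> octagons F v j <= octagons F' v j.
Proof.
move=> sF.
have lm x a b : lnk F x a b -> lnk F' x a b.
  by case/and3P => nab Ea Eb; rewrite /lnk nab !(E_mono sF).
apply: leq_sum => i _; apply: leq_sum => p _; apply: leq_sum => q _.
case c4: (four_cycle (lnk F _) _ _ _ _) => //.
case/and5P: c4 => lij ljp lpq lqi nn.
by rewrite /four_cycle (lm _ _ _ lij) (lm _ _ _ ljp) (lm _ _ _ lpq) (lm _ _ _ lqi) nn.
Qed.

Lemma octagons_edge k (F : {set vtx k * vtx k}) v j : ~~ E F v j -> octagons F v j = 0.
Proof.
move=> nE; rewrite /octagons big1 // => i _; rewrite big1 // => p _; rewrite big1 // => q _.
by rewrite /four_cycle /lnk togK (negPf nE) andbF.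
Qed.

(** If [2 * N <= f] the diagonal term is absorbed, so [f ^ 2 <= N * S], and one factor [f] cancels
    from the fourth power. Otherwise [(2 * N) ^ 7] is already small enough. *)
Lemma sparse_arith (b k n N f S : nat) : 0 < b -> k < n ->
  2 * f ^ 2 <= N * (S + 2 * f) -> S <= 2 * (f * k.+1) ->
  S ^ 4 <= (2 * N) ^ 3 * (n ^ 4 * (24 * b * n ^ 2 * (2 * f) + 2 * n * S)) ->
  f ^ 7 <= (384 * b + 32) * N ^ 7 * n ^ 6.
Proof.
move=> b_gt0 ltkn Qf leS totS.
have n_gt0 : 0 < n by lia.
have [ltf|lef] := ltnP f (2 * N).
  apply: (@leq_trans ((2 * N) ^ 7)); first by rewrite leq_exp2r // ltnW.
  rewrite expnMn -mulnA; apply: leq_mul; first by lia.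
  by rewrite leq_pmulr // expn_gt0 n_gt0.
have [->|f_gt0] := posnP f; first by rewrite exp0n.
have fNS : f ^ 2 <= N * S.
  by move: Qf; rewrite -!mulnn; nia.
rewrite -(leq_pmul2l f_gt0) -expnS.
have -> : f ^ 8 = (f ^ 2) ^ 4 by rewrite -expnM.
apply: (@leq_trans ((N * S) ^ 4)); first by rewrite leq_exp2r.
rewrite expnMn; apply: (@leq_trans (N ^ 4 * ((2 * N) ^ 3 * (n ^ 4 * (f * (48 * b + 4) * n ^ 2))))).
  rewrite leq_mul2l; apply/orP; right; apply: leq_trans totS _.
  do 2!(rewrite leq_mul2l; apply/orP; right).
  have : 2 * n * S <= 4 * f * n ^ 2 by rewrite -mulnn; nia.
  lia.
rewrite expnMn.
have -> : N ^ 7 = N ^ 4 * N ^ 3 by rewrite -expnD.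
have -> : n ^ 6 = n ^ 4 * n ^ 2 by rewrite -expnD.
rewrite (_ : 2 ^ 3 = 8) //; lia.
Qed.

(** * Edges on few octagons, and cycles among the remaining edges *)

Section SparseEdges.
Variables (k b : nat) (F : {set vtx k * vtx k}).
Hypothesis sF : F \subset dO_edges k.
Let n := 2 * k + 1.
Let N := 'C(n, k).
(** Six octagon vertices times [4 * b], the length of the cycle to be avoided. *)
Let K := 24 * b * n ^ 2.

(** The counts at the two ends concern different octagons, with base point below the edge for one
    end and above it for the other, so both are tested. *)
Definition sparse_edges : {set vtx k * vtx k} :=
  [set p in F | [forall j, (p.2 == tog p.1 j) ==>
     (octagons F p.1 j <= K) && (octagons F p.2 j <= K)]].

Lemma sparse_sub : sparse_edges \subset F.
Proof. by apply/subsetP => p; rewrite inE => /andP[]. Qed.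

Lemma sparse_octagons v j : E sparse_edges v j -> octagons F v j <= K.
Proof.
case/orP; rewrite inE /= => /andP[_ /forallP/(_ j)]; first by rewrite eqxx => /andP[].
by rewrite togK eqxx => /andP[].
Qed.

Lemma dense_octagons v u : adjF (F :\: sparse_edges) v u ->
  exists j, u = tog v j /\ ((K < octagons F v j) || (K < octagons F u j)).
Proof.
have dense p : p \in F :\: sparse_edges ->
    exists j, p.2 = tog p.1 j /\ ((K < octagons F p.1 j) || (K < octagons F p.2 j)).
  rewrite !inE => /andP[+ pF]; rewrite pF /= => /forallPn[j].
  by rewrite negb_imply negb_and -!ltnNge => /andP[/eqP e2 oct]; exists j.
case/orP => /dense[j /= [-> oct]]; exists j; first by [].
by rewrite togK orbC.
Qed.

Lemma dense_no_cycle : ~~ hasCycle (4 * b + 6) F -> 0 < b ->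
  ~~ hasCycle (4 * b) (F :\: sparse_edges).
Proof.
move=> nocyc b_gt0; apply: contra nocyc => /hasCycleP[s [ss us cs]].
case: s ss us cs => [|v [|u R]] /= ss us cs; [lia | lia |].
have sDF := subsetDl F sparse_edges.
have [j [uE oct]] : exists j, u = tog v j /\ ((K < octagons F v j) || (K < octagons F u j)).
  by apply: dense_octagons; case/andP: cs.
have cF : cycle (adjF F) [:: v, u & R].
  move: cs; rewrite -[_ && _]/(path (adjF (F :\: sparse_edges)) v (rcons (u :: R) v)).
  apply: sub_path => y z /orP[] /(subsetP sDF) yz; apply/orP; [by left | by right].
have leK : 6 * size R * n ^ 2 <= K.
  by rewrite /K leq_mul2r; apply/orP; right; clear -ss; move: (size R) ss => r; lia.
have -> : 4 * b + 6 = size R + 8 by clear -ss; move: (size R) ss => r; lia.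
case/orP: oct => oct.
  by apply: (@octagon_glue _ _ v j); rewrite -?uE //; exact: leq_ltn_trans leK oct.
have vE : v = tog u j by rewrite uE togK.
(* The octagons are based at [u], so the cycle is read backwards from there. *)
rewrite -size_rev; apply: (@octagon_glue _ _ u j); rewrite -?vE.
- case/andP: cF => evu pR; rewrite /= adjF_sym evu /=.
  exact: reverse_path (adjF_sym F) pR.
- move: us; rewrite inE negb_or -andbA => /and4P[nvu nvR nuR uR].
  by rewrite /= inE negb_or !mem_rev rev_uniq (eq_sym u) nvu nvR nuR uR.
- rewrite size_rev; exact: leq_ltn_trans leK oct.
Qed.

Lemma sparse_bound : 0 < b -> #|sparse_edges| ^ 7 <= (384 * b + 32) * N ^ 7 * n ^ 6.
Proof.
move=> b_gt0; set L := sparse_edges; set f := #|L|.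
have sL : L \subset dO_edges k := subset_trans sparse_sub sF.
pose s x := \sum_i \sum_j (lnk L x i j : nat).
pose nd x := \sum_i \sum_j \sum_p \sum_q (four_cycle (lnk L x) i j p q : nat).
pose S := \sum_x s x.
have SQ : S + 2 * f = \sum_A deg L A ^ 2 := sum_lnk sL.
have Qf : 2 * f ^ 2 <= N * (S + 2 * f) by rewrite SQ; exact: sum_deg_sqr sL.
have leS : S <= 2 * (f * k.+1).
  apply: (@leq_trans (\sum_A deg L A ^ 2)); first by rewrite -SQ leq_addr.
  rewrite mulnA -(sum_deg sL) big_distrl; apply: leq_sum => A _ /=.
  by rewrite -mulnn leq_mul2l (deg_le sL) orbT.
(* A 4-cycle of a link is charged to the edge of [L] in its first position, which lies on at most
   [K] octagons counted from its end. *)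
have ndK : \sum_x nd x <= K * (2 * f).
  rewrite -sum_octagons -(sum_deg sL) big_distrr; apply: leq_sum => v _ /=.
  rewrite /deg big_distrr; apply: leq_sum => j _ /=.
  have [Evj|nE] := boolP (E L v j); last by rewrite octagons_edge.
  rewrite muln1; exact: leq_trans (octagons_mono v j sparse_sub) (sparse_octagons Evj).
have quartic x : s x ^ 4 <= n ^ 4 * (nd x + 2 * n * s x).
  have := four_cycle_count (lnk_sym L x) (erefl (s x)).
  by rewrite card_ord.
have s0 x : x \notin far k -> s x = 0.
  move=> nx; rewrite /s big1 // => i _; rewrite big1 // => j _.
  by case lij: (lnk L x i j) => //; rewrite (lnk_far sL lij) in nx.
(* The fourth power mean, from two applications of Cauchy-Schwarz. *)
have powS : S ^ 4 <= #|far k| ^ 3 * \sum_(x in far k) s x ^ 4.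
  have SE : S = \sum_(x in far k) s x.
    by rewrite [RHS]big_mkcond; apply: eq_bigr => x _; case: ifPn => // /s0.
  have c1 := sum_nat_sqr_le (mem (far k)) s.
  have c2 := sum_nat_sqr_le (mem (far k)) (fun x => s x ^ 2).
  rewrite (expnM S 2 2) SE.
  apply: (@leq_trans ((#|far k| * \sum_(x in far k) s x ^ 2) ^ 2)).
    by rewrite leq_exp2r.
  rewrite expnMn (expnD _ 2 1) expn1 -mulnA leq_mul2l; apply/orP; right.
  by apply: leq_trans c2 _; under eq_bigr do rewrite -expnM.
have totS : S ^ 4 <= (2 * N) ^ 3 * (n ^ 4 * (K * (2 * f) + 2 * n * S)).
  apply: leq_trans powS _; apply: leq_mul; first by rewrite leq_exp2r // (card_far sL).
  apply: (@leq_trans (\sum_x n ^ 4 * (nd x + 2 * n * s x))).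
    rewrite big_mkcond; apply: leq_sum => x _; case: ifP => // _; exact: quartic.
  by rewrite -big_distrr /= leq_mul2l big_split -big_distrr /= leq_add2r ndK orbT.
have ltkn : k < n by rewrite /n; clear; lia.
exact: sparse_arith b_gt0 ltkn Qf leS totS.
Qed.

End SparseEdges.

(** * Densities *)

Lemma nat_root_ceil (l n : nat) : (0 < l) -> (0 < n) ->
  exists t, [/\ (1 < t), (n < t ^ l) & (t.-1 ^ l <= n)].
Proof.
move=> l_gt0 n_gt0.
have ex : exists t, (n < t ^ l).
  exists n.+1; apply: leq_trans (_ : n.+1 ^ 1 <= _); first by rewrite expn1.
  by rewrite leq_exp2l.
case: (ex_minnP ex) => t ltn min_t; exists t; split => //.
  by case: t ltn {min_t} => [|[|t]] //; rewrite ?exp1n ?exp0n // ltnNge n_gt0.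
rewrite leqNgt; apply/negP => /min_t; case: t ltn {min_t} => [|t] /=.
  by rewrite exp0n.
by rewrite ltnn.
Qed.

Open Scope R_scope.

Lemma INR_leq (a b : nat) : (a <= b)%nat -> INR a <= INR b.
Proof. by move/leP/le_INR. Qed.

Lemma INR_addn (a b : nat) : INR (a + b)%nat = INR a + INR b.
Proof. exact: plus_INR. Qed.

Lemma INR_muln (a b : nat) : INR (a * b)%nat = INR a * INR b.
Proof. exact: mult_INR. Qed.

Lemma INR_expn (a b : nat) : INR (expn a b) = INR a ^ b.
Proof. by elim: b => [|b IHb] //; rewrite expnS INR_muln IHb. Qed.

Definition INRE := (INR_addn, INR_muln, INR_expn).

Lemma pow_le_inv (x y : R) (n : nat) : (0 < n)%nat -> 0 <= x -> 0 <= y -> x ^ n <= y ^ n -> x <= y.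
Proof.
move=> n_gt0 x0 y0 le_n; apply: Rnot_lt_le => ltyx.
case: n n_gt0 le_n => // n _ /=.
have : y ^ n <= x ^ n by apply: pow_incr; lra.
have : 0 < x ^ n by apply: pow_lt; lra.
have : 0 <= y ^ n by apply: pow_le.
nra.
Qed.

Lemma Rpower_root_pow (x : R) (n : nat) : 0 < x -> (0 < n)%nat -> Rpower x (/ INR n) ^ n = x.
Proof.
move=> x0 n0; rewrite -Rpower_pow; last exact: exp_pos.
rewrite Rpower_mult Rinv_l ?Rpower_1 //; apply: not_0_INR; exact/eqP/lt0n_neq0.
Qed.

(** Nonnegativity of [B] covers the value 0 with which the maximum starts. *)
Lemma ex_dO_le k m (B : R) : 0 <= B ->
  (forall F : {set vtx k * vtx k}, F \subset dO_edges k -> ~~ hasCycle m F -> INR #|F| <= B) ->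
  INR (ex_dO k m) <= B.
Proof.
move=> B0 leB; rewrite /ex_dO; apply: (big_ind (fun a => INR a <= B)) => //.
  by move=> a b lea leb; rewrite /maxn; case: ifP.
by move=> F /andP[sF nF]; exact: leB.
Qed.

Lemma cycle4l_density (l : nat) : (1 < l)%nat -> exists2 C, 0 < C &
  forall k (F : {set vtx k * vtx k}), (0 < k)%nat -> F \subset dO_edges k ->
    ~~ hasCycle (4 * l) F ->
    INR #|F| <= C * Rpower (INR k) (- (1 / 2) + 1 / (2 * INR l)) * INR (e_dO k).
Proof.
move=> l_gt1; have l_gt0 := ltnW l_gt1.
have l2 : 2 <= INR l by have := INR_leq l_gt1; rewrite /=; lra.
(* 594 = 33 * 6 * 3, from [t <= 6 * y] and [2 * k + 1 <= 3 * k]; the comparison is made after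
   squaring and uses C <= C^2. *)
exists (594 * INR l) => [|k F k_gt0 sF nocyc]; first lra.
have k1 : 1 <= INR k by have := INR_leq k_gt0.
have [|t [t_gt1 ltn let1]] := @nat_root_ceil l (2 * k + 1) l_gt0; first by rewrite addn1.
have bound := INR_leq (cycle4l_bound sF l_gt1 (ltnW t_gt1) ltn nocyc).
rewrite !INRE in bound.
set y := Rpower (INR k) (/ INR l).
have y0 : 0 < y by exact: exp_pos.
have yl : y ^ l = INR k by apply: Rpower_root_pow => //; lra.
have n3 : INR 2 * INR k + INR 1 <= 3 * INR k by rewrite /=; lra.
have let3 : INR t.-1 <= 3 * y.
  apply: (@pow_le_inv _ _ l) => //; [exact: pos_INR | lra |].
  rewrite Rpow_mult_distr yl.
  have := INR_leq let1; rewrite !INRE => le1.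
  have : 3 <= 3 ^ l by rewrite -{1}[3]pow_1; apply: Rle_pow; [lra | exact/leP].
  nra.
have t6 : INR t <= 6 * y.
  have -> : INR t = INR t.-1 + 1 by rewrite -{1}(prednK (ltnW t_gt1)) S_INR.
  have : 1 <= INR t.-1 by rewrite -[1]/(INR 1); apply: INR_leq; rewrite -ltnS prednK // ltnW.
  lra.
set z := Rpower _ _.
have z0 : 0 < z by exact: exp_pos.
have zy : z ^ 2 * INR k = y.
  rewrite /z /y -Rpower_pow; last exact: exp_pos.
  rewrite Rpower_mult -{2}[INR k]Rpower_1; last lra.
  rewrite -Rpower_plus; congr Rpower; rewrite /=; field; lra.
set M := INR 'C(2 * k + 1, k) in bound.
have M0 : 0 <= M by exact: pos_INR.
have eE : INR (e_dO k) = M * (INR k + 1) by rewrite e_dOE INR_muln S_INR.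
have f0 : 0 <= INR #|F| by exact: pos_INR.
apply: (@pow_le_inv _ _ 2) => //.
  by rewrite eE; apply: Rmult_le_pos; nra.
apply: Rle_trans bound _.
have -> : INR 33 = 33 by rewrite /=; lra.
have step1 : 33 * INR l * INR t * (INR 2 * INR k + INR 1) * M ^ 2 <=
    33 * INR l * (6 * y) * (3 * INR k) * M ^ 2.
  apply: Rmult_le_compat_r; first by nra.
  apply: Rmult_le_compat => //; [|by rewrite /=; lra|].
    by apply: Rmult_le_pos; [lra | exact: pos_INR].
  by apply: Rmult_le_compat_l; lra.
apply: Rle_trans step1 _.
rewrite -zy eE.
have -> : 33 * INR l * (6 * (z ^ 2 * INR k)) * (3 * INR k) * M ^ 2 =
   (594 * INR l) * (z ^ 2 * M ^ 2) * INR k ^ 2 by ring.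
have -> : (594 * INR l * z * (M * (INR k + 1))) ^ 2 =
   (594 * INR l) ^ 2 * (z ^ 2 * M ^ 2) * (INR k + 1) ^ 2 by ring.
have w0 : 0 <= z ^ 2 * M ^ 2 by apply: Rmult_le_pos; apply: pow_le; lra.
apply: Rmult_le_compat.
- by apply: Rmult_le_pos; lra.
- by apply: pow_le; lra.
- apply: Rmult_le_compat_r => //; nra.
- by apply: pow_incr; lra.
Qed.

Lemma cycle4l2_density (l : nat) : (2 < l)%nat -> exists2 C, 0 < C &
  forall k (F : {set vtx k * vtx k}), (0 < k)%nat -> F \subset dO_edges k ->
    ~~ hasCycle (4 * l + 2) F ->
    INR #|F| <= C * Rpower (INR k) (- (1 / 7)) * INR (e_dO k).
Proof.
(* With l = b + 1 the forbidden length 4 l + 2 is 4 b + 6, and the dense edges contain no cycle of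
   length 4 b. *)
case: l => // b b_gt1; rewrite ltnS in b_gt1; have b_gt0 := ltnW b_gt1.
have [C2 C20 dens2] := cycle4l_density b_gt1.
have b2 : 2 <= INR b by have := INR_leq b_gt1; rewrite /=; lra.
(* 729 = 3^6, from 2 k + 1 <= 3 (k + 1) in the sixth power. *)
pose C1 := 729 * (384 * INR b + 32).
exists (C1 + C2) => [|k F k_gt0 sF nocyc]; first by rewrite /C1; lra.
have k1 : 1 <= INR k by have := INR_leq k_gt0.
set z := Rpower _ _.
have z0 : 0 < z by exact: exp_pos.
have z7 : z ^ 7 * INR k = 1.
  rewrite /z -Rpower_pow; last exact: exp_pos.
  rewrite Rpower_mult -{2}[INR k]Rpower_1; last lra.
  rewrite -Rpower_plus (_ : _ + 1 = 0) ?Rpower_O //; [lra | rewrite /=; field].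
pose L := sparse_edges b F.
have sL : L \subset F := sparse_sub b F.
have cF : INR #|F| = INR #|L| + INR #|F :\: L|.
  by rewrite -INR_addn -(cardsID L F) (setIidPr sL).
have nocycD : ~~ hasCycle (4 * b) (F :\: L).
  by apply: dense_no_cycle => //; move: nocyc; rewrite mulnS addnC addnA addnC.
have boundD := dens2 k _ k_gt0 (subset_trans (subsetDl _ _) sF) nocycD.
have boundL := INR_leq (sparse_bound sF b_gt0).
have M0 : 0 <= INR 'C(2 * k + 1, k) by exact: pos_INR.
have eE : INR (e_dO k) = INR 'C(2 * k + 1, k) * (INR k + 1) by rewrite e_dOE INR_muln S_INR.
have e0 : 0 <= INR (e_dO k) by exact: pos_INR.
have leD : INR #|F :\: L| <= C2 * z * INR (e_dO k).
  apply: Rle_trans boundD _; apply: Rmult_le_compat_r => //.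
  (* For b >= 2 the exponent -1/2 + 1/(2 b) is at most -1/4, below -1/7. *)
  apply: Rmult_le_compat_l; first lra; apply: Rle_Rpower => //.
  have : / INR b <= / 2 by apply: Rinv_le_contravar; lra.
  have -> : 1 / (2 * INR b) = / 2 * / INR b by field; lra.
  lra.
have C1_1 : 1 <= C1 by rewrite /C1; lra.
suff leL : INR #|L| <= C1 * z * INR (e_dO k) by rewrite cF; lra.
apply: (@pow_le_inv _ _ 7) => //; first exact: pos_INR.
  by apply: Rmult_le_pos => //; nra.
rewrite !INRE in boundL; apply: Rle_trans boundL _; rewrite eE.
set M := INR _ in M0 *.
have -> : (C1 * z * (M * (INR k + 1))) ^ 7 =
    C1 ^ 7 * (M ^ 7 * (z ^ 7 * (INR k + 1)) * (INR k + 1) ^ 6) by ring.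
have n3 : INR 2 * INR k + INR 1 <= 3 * (INR k + 1) by rewrite /=; lra.
have n6 : (INR 2 * INR k + INR 1) ^ 6 <= (3 * (INR k + 1)) ^ 6.
  by apply: pow_incr; split => //; rewrite /=; lra.
have zk : 1 <= z ^ 7 * (INR k + 1).
  have : 0 < z ^ 7 by apply: pow_lt.
  rewrite -z7; nra.
have M7 : 0 <= M ^ 7 by apply: pow_le.
have k6 : 0 <= (INR k + 1) ^ 6 by apply: pow_le; lra.
apply: Rle_trans (_ : C1 * (M ^ 7 * 1 * (INR k + 1) ^ 6) <= _).
  have -> : C1 * (M ^ 7 * 1 * (INR k + 1) ^ 6) =
      (384 * INR b + 32) * M ^ 7 * (3 * (INR k + 1)) ^ 6 by rewrite /C1; ring.
  have -> : INR 384 = 384 by rewrite INR_IZR_INZ.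
  have -> : INR 32 = 32 by rewrite INR_IZR_INZ.
  apply: Rmult_le_compat_l => //; apply: Rmult_le_pos => //; lra.
apply: Rmult_le_compat; first lra.
- by apply: Rmult_le_pos => //; lra.
- by rewrite -{1}[C1]pow_1; apply: Rle_pow => //; exact/leP.
- apply: Rmult_le_compat_r => //; apply: Rmult_le_compat_l => //.
Qed.

Lemma density_nonneg (C x y : R) k : 0 < C -> 0 <= C * Rpower x y * INR (e_dO k).
Proof.
move=> C0; apply: Rmult_le_pos; last exact: pos_INR.
by apply: Rmult_le_pos; [lra | apply/Rlt_le/exp_pos].
Qed.

Lemma density_weaken (C x y y' f e : R) : 0 < C -> 1 <= x -> 0 <= e -> y <= y' ->
  f <= C * Rpower x y * e -> f <= C * Rpower x y' * e.
Proof.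
move=> C0 x1 e0 leyy le; apply: Rle_trans le _; apply: Rmult_le_compat_r => //.
apply: Rmult_le_compat_l; [lra | exact: Rle_Rpower].
Qed.

Theorem theorem1p2 :
  (* (i) *)
  (forall l : nat, (3 <= l)%nat ->
     exists C : R, exists K : nat, forall k : nat, (K <= k)%nat ->
       INR (ex_dO k (4 * l)) <= C * Rpower (INR k) (- (1 / 2) + 1 / INR l) * INR (e_dO k))
  /\
  (* (ii) *)
  (forall l : nat, (3 <= l)%nat ->
     ((l \in [:: 3; 5; 7; 9]%nat) ->
       exists C : R, exists K : nat, forall k : nat, (K <= k)%nat ->
         INR (ex_dO k (4 * l + 2)) <= C * Rpower (INR k) (- (1 / (2 * INR l + 1))) * INR (e_dO k))
     /\
     ((l \notin [:: 3; 5; 7; 9]%nat) ->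
       exists C : R, exists K : nat, forall k : nat, (K <= k)%nat ->
         INR (ex_dO k (4 * l + 2)) <=
           C * Rpower (INR k) (- (1 / 16) + 1 / (8 * (INR l - 1))) * INR (e_dO k)))
  /\
  (* (iii) *)
  (forall k : nat, (1 <= k)%nat -> INR (ex_dO k 6) <= 5 / 6 * INR (e_dO k))
  /\
  (forall eps : R, 0 < eps -> exists K : nat, forall k : nat, (K <= k)%nat ->
     INR (ex_dO k 8) <= (2 / 3 + eps) * INR (e_dO k))
  /\
  (forall eps : R, 0 < eps -> exists K : nat, forall k : nat, (K <= k)%nat ->
     INR (ex_dO k 10) <= (2 / 3 + eps) * INR (e_dO k)).
Proof.
split=> [l l3|].
  have [C C0 dens] := cycle4l_density (ltnW l3); exists C, 1%nat => k k1.
  apply: ex_dO_le => [|F sF nF]; first exact: density_nonneg.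
  have le1 : 1 <= INR k by have := INR_leq k1.
  have l0 : 3 <= INR l by have := INR_leq l3; rewrite /=; lra.
  apply: density_weaken (dens k F k1 sF nF) => //; first exact: pos_INR.
  have -> : 1 / (2 * INR l) = / 2 * (1 / INR l) by field; lra.
  have : 0 < 1 / INR l by apply: Rdiv_lt_0_compat; lra.
  lra.
split=> [l l3|].
  have [C C0 dens] := cycle4l2_density l3.
  have l0 : 3 <= INR l by have := INR_leq l3; rewrite /=; lra.
  have weak y k : - (1 / 7) <= y -> (1 <= k)%nat ->
      INR (ex_dO k (4 * l + 2)) <= C * Rpower (INR k) y * INR (e_dO k).
    move=> le_y k1; apply: ex_dO_le => [|F sF nF]; first exact: density_nonneg.
    have le1 : 1 <= INR k by have := INR_leq k1.
    by apply: density_weaken (dens k F k1 sF nF) => //; exact: pos_INR.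
  (* The exponent -1/7 serves both cases: 2 l + 1 >= 7, and -1/7 < -1/16. *)
  split=> _; exists C, 1%nat => k; apply: weak.
    have : / (2 * INR l + 1) <= / 7 by apply: Rinv_le_contravar; lra.
    lra.
  have : 0 < 1 / (8 * (INR l - 1)) by apply: Rdiv_lt_0_compat; lra.
  lra.
split=> [k k1|].
  apply: ex_dO_le => [|F sF nF]; first by have := pos_INR (e_dO k); lra.
  have := INR_leq (cycle6_bound k1 sF nF).
  by rewrite !INR_muln /=; lra.
split=> eps eps0.
  (* Octagons are the case l = 2, of density O(k^(-1/4)); from [16 * C ^ 4 <= k] on it is at most
     1/2, below 2/3. *)
  have [C C0 dens] := cycle4l_density (isT : (1 < 2)%nat).
  have [K gtK] := INR_unbounded (16 * C ^ 4); exists K.+1 => k leK.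
  have k_gt0 : (0 < k)%nat by exact: leq_trans leK.
  have e0 := pos_INR (e_dO k).
  apply: ex_dO_le => [|F sF nF]; first by apply: Rmult_le_pos; lra.
  apply: Rle_trans (dens k F k_gt0 sF nF) _; apply: Rmult_le_compat_r => //.
  set z := Rpower _ _.
  have k1 : 1 <= INR k by have := INR_leq k_gt0.
  have z0 : 0 < z by exact: exp_pos.
  have z4 : z ^ 4 * INR k = 1.
    rewrite /z -Rpower_pow; last exact: exp_pos.
    rewrite Rpower_mult -{2}[INR k]Rpower_1; last lra.
    rewrite -Rpower_plus (_ : _ + 1 = 0) ?Rpower_O //; [lra | rewrite /=; field].
  suff: C * z <= / 2 by lra.
  apply: (@pow_le_inv _ _ 4) => //; [nra | lra |].
  have ltk : 16 * C ^ 4 <= INR k by have := INR_leq (ltnW leK); lra.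
  have z40 : 0 < z ^ 4 by apply: pow_lt.
  rewrite Rpow_mult_distr; nra.
(* The error term of the decagon bound is 1400 / (48 k), less than 30 / k. *)
have [K gtK] := INR_unbounded (30 / eps); exists K.+1 => k leK.
have k_gt0 : (0 < k)%nat by exact: leq_trans leK.
have e0 := pos_INR (e_dO k).
apply: ex_dO_le => [|F sF nF]; first by apply: Rmult_le_pos; lra.
have k1 : 1 <= INR k by have := INR_leq k_gt0.
have := INR_leq (cycle10_bound sF k_gt0 nF).
have i48 : INR 48 = 48 by rewrite INR_IZR_INZ.
have i32 : INR 32 = 32 by rewrite INR_IZR_INZ.
have i1400 : INR 1400 = 1400 by rewrite INR_IZR_INZ.
rewrite -e_dOE !INRE i48 i32 i1400 => bound.
have ltk : 30 <= INR k * eps.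
  have : 30 / eps <= INR k by have := INR_leq (ltnW leK); lra.
  move/(Rmult_le_compat_r eps _ _ (Rlt_le _ _ eps0)).
  by rewrite (_ : 30 / eps * eps = 30) //; field; lra.
have : 48 * INR k * INR #|F| <= 48 * INR k * ((2 / 3 + eps) * INR (e_dO k)).
  nra.
by apply: Rmult_le_reg_l; lra.
Qed.
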